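(* Let $(\mathcal{A},\mathbf{m})$ be a multi-arrangement. If $(\mathcal{A},\mathbf{m})$ is free, then $\mathcal{A}$ is totally formal.
   Context: Let $\mathbb{K}$ be a field, $V$ a finite-dimensional $\mathbb{K}$-vector space, $S=\mathrm{Sym}(V^* )$. An arrangement $\mathcal{A}$ in $V$ is a finite set of linear hyperplanes $H=\ker\alpha_H$ ($0\ne\alpha_H\in V^*$). $L=L(\mathcal{A})$ is the set of intersections of hyperplanes (including $V$), ordered by reverse inclusion and ranked by codimension; $L_k$ is the set of flats of rank $k$; $r=r(\mathcal{A})$ is the codimension of $T(\mathcal{A})=\bigcap_{H\in\mathcal{A}}H$; $\mathcal{A}_X=\{H\in\mathcal{A}:X\subseteq H\}$. A multi-arrangement $(\mathcal{A},\mathbf{m})$ is an arrangement with $\mathbf{m}:\mathcal{A}\to\mathbb{Z}_{>0}$; it is free if $D(\mathcal{A},\mathbf{m})=\{\theta\in\mathrm{Der}_{\mathbb{K}}(S):\theta(\alpha_H)\in\langle\alpha_H^{\mathbf{m}(H)}\rangle\ \forall H\in\mathcal{A}\}$ is a free $S$-module. Formality: set $R_0(\mathcal{A})=T(\mathcal{A})^*$ and for $1\le k\le r$ define recursively $R_k(\mathcal{A})=\ker\big(\pi_{k-1}:\bigoplus_{X\in L_{k-1}}R_{k-1}(\mathcal{A}_X)\to R_{k-1}(\mathcal{A})\big)$, where $\pi_{k}$ is the sum of the natural maps $R_{k}(\mathcal{A}_X)\to R_{k}(\mathcal{A})$ (for $k=0$, restriction of linear functionals; for $k\ge1$, the inclusions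 induced on kernels by the inclusion of summands). One has $R_2(\mathcal{A})=F(\mathcal{A}):=\ker(\bigoplus_{H\in\mathcal{A}}\mathbb{K}e_H\to V^*,\ e_H\mapsto\alpha_H)$. $\mathcal{A}$ is $2$-formal (formal) if $F(\mathcal{A})$ is spanned by relations among three linear forms, i.e. $\pi_2:\bigoplus_{X\in L_2}F(\mathcal{A}_X)\to F(\mathcal{A})$ is surjective. For $k\ge3$, $\mathcal{A}$ is $k$-formal if it is $(k-1)$-formal and $\pi_k:\bigoplus_{X\in L_k}R_k(\mathcal{A}_X)\to R_k(\mathcal{A})$ is surjective (for $k=r$ the latter condition is automatic). $\mathcal{A}$ is totally formal if $\mathcal{A}_X$ is $k$-formal for all $2\le k\le r(X)$ and all $X\in L(\mathcal{A})$. *)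

(* Defs.v *)
From HB Require Import structures.
From mathcomp Require Import all_boot all_order all_algebra.
From mathcomp Require Import mpoly.

Set Implicit Arguments.
Unset Strict Implicit.
Unset Printing Implicit Defensive.

Import GRing.Theory.
Local Open Scope ring_scope.

Section FiniteSums.
Variables (K : fieldType) (F : finType) (U : vectType K).

Definition coordf (X : F) (f : {ffun F -> U}) : U := f X.

Fact coordf_linear X : linear (coordf X).
Proof. by move=> a f g; rewrite /coordf !ffunE. Qed.

HB.instance Definition _ X :=
  GRing.isLinear.Build K {ffun F -> U} U *:%R (coordf X) (coordf_linear X).

Definition sumf (f : {ffun F -> U}) : U := \sum_X f X.

Fact sumf_linear : linear sumf.
Proof.
move=> a f g; rewrite /sumf scaler_sumr -big_split /=.
by apply: eq_bigr => X _; rewrite !ffunE.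
Qed.

HB.instance Definition _ :=
  GRing.isLinear.Build K {ffun F -> U} U *:%R sumf sumf_linear.

(* The direct sum of the subspaces [W X], X in [P], of [U]; families are
   extended by 0 outside [P]. *)
Definition dsumv (P : pred F) (W : F -> {vspace U}) : {vspace {ffun F -> U}} :=
  (\bigcap_X (linfun (coordf X) @^-1: (if P X then W X else 0)))%VS.

Lemma mem_dsumv P W (f : {ffun F -> U}) :
  reflect (forall X, f X \in (if P X then W X else 0%VS)) (f \in dsumv P W).
Proof.
have E X : (f \in linfun (coordf X) @^-1: (if P X then W X else 0))%VS =
           (f X \in if P X then W X else 0%VS).
  by rewrite -memv_preim lfunE.
rewrite /dsumv memvE; apply: (iffP subv_bigcapP) => H X; last first.
  by rewrite -memvE E.
by have := H X isT; rewrite -memvE E.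
Qed.

End FiniteSums.

Section Arrangements.
Variables (K : fieldType) (V : vectType K).

(* [alpha H] is the chosen linear form alpha_H; the hyperplanes
   [lker (alpha H)] are pairwise distinct, so the index type is the set A. *)
Record arrangement := Arrangement {
  hyp :> finType;
  alpha : hyp -> 'Hom(V, K^o);
  alpha_neq0 : forall H, alpha H != 0;
  hyp_inj : injective (fun H => lker (alpha H))
}.

Definition codimv (X : {vspace V}) : nat := (\dim {:V} - \dim X)%N.

Section Fixed.
Variable A : arrangement.

(* Subarrangements of A are given by B : {set A}. *)
Implicit Types (B : {set A}) (X : {vspace V}).

Definition arr_center B : {vspace V} := (\bigcap_(H in B) lker (alpha H))%VS.

Definition flats B : seq {vspace V} :=
  undup [seq arr_center C | C <- enum (powerset B)].

Definition localization B X : {set A} :=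
  [set H in B | (X <= lker (alpha H))%VS].

(* The set L(A), as a finite type indexing the direct sums below. *)
Definition flat : finType := seq_sub (flats [set: A]).

Definition flat_of_rank (k : nat) B : pred flat :=
  fun Y => (val Y \in flats B) && (codimv (val Y) == k).

Definition res_center B (f : 'Hom(V, K^o)) :
    'Hom(subvs_of (arr_center B), K^o) :=
  (f \o linfun vsval)%VF.

Fact res_center_linear B : linear (res_center B).
Proof. by move=> a f g; rewrite /res_center comp_lfunDl comp_lfunZl. Qed.

HB.instance Definition _ B :=
  GRing.isLinear.Build K 'Hom(V, K^o) 'Hom(subvs_of (arr_center B), K^o) *:%R
    (res_center B) (res_center_linear B).

(* Ambient space of R_k: since (A_X)_Y = A_Y for X included in Y, the natural
   maps R_k(B_X) -> R_k(B), k >= 1, become inclusions of subspaces of it. *)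
Fixpoint Rambient (k : nat) : vectType K :=
  match k with
  | 0 => 'Hom(V, K^o)
  | k'.+1 => {ffun flat -> Rambient k'}
  end.

(* [Rsub k B] is R_(k+1)(B).  The only flat of rank 0 is V, and T(B_V) = V
   (lemmas [flats_rank0] and [arr_center_localization0]); hence the sum defining
   R_1(B) has the single term R_0(B_V) = V^*, and R_1(B) is the kernel of the
   restriction V^* -> T(B)^* = R_0(B). *)
Fixpoint Rsub (k : nat) : {set A} -> {vspace Rambient k} :=
  match k with
  | 0 => fun B => lker (linfun (res_center B))
  | k'.+1 => fun B =>
      (dsumv (flat_of_rank k'.+1 B) (fun Y => Rsub k' (localization B (val Y)))
       :&: lker (linfun (@sumf K flat (Rambient k'))))%VS
  end.

(* Surjectivity of pi_k : (+)_(X in L_k(B)) R_k(B_X) -> R_k(B), for k >= 1. *)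
Definition pi_surjective (k : nat) B : Prop :=
  (linfun (@sumf K flat (Rambient k.-1)) @:
     dsumv (flat_of_rank k B)
           (fun Y => Rsub k.-1 (localization B (val Y))))%VS = Rsub k.-1 B.

(* Only meaningful for k >= 2. *)
Fixpoint k_formal (k : nat) B : Prop :=
  match k with
  | (_.+1 as k').+1 => k_formal k' B /\ pi_surjective k B
  | _ => True
  end.

Definition totally_formal : Prop :=
  forall X, X \in flats [set: A] ->
  forall k, (2 <= k <= codimv X)%N -> k_formal k (localization [set: A] X).

Lemma mem_Rsub0 B (f : 'Hom(V, K^o)) :
  reflect {in arr_center B, forall v, f v = 0} (f \in Rsub 0 B).
Proof.
rewrite memv_ker lfunE /=; apply: (iffP eqP) => [f0 v Bv | f0].
  by have /lfunP/(_ (Subvs Bv)) := f0; rewrite comp_lfunE lfunE /= zero_lfunE.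
by apply/lfunP => v; rewrite comp_lfunE lfunE zero_lfunE f0 ?subvsP.
Qed.

Lemma mem_RsubS k B (f : {ffun flat -> Rambient k}) :
  (f \in Rsub k.+1 B) =
  (f \in dsumv (flat_of_rank k.+1 B)
               (fun Y => Rsub k (localization B (val Y))))
  && (\sum_Y f Y == 0).
Proof. by rewrite /= memv_cap memv_ker lfunE. Qed.

Lemma flats_rank0 B X :
  (X \in flats B) && (codimv X == 0%N) = (X == fullv).
Proof.
rewrite /codimv subn_eq0; apply/andP/eqP => [[_ leX]|->].
  by apply/eqP; rewrite eqEdim subvf.
split=> //; rewrite mem_undup; apply/mapP; exists set0.
  by rewrite mem_enum powersetE sub0set.
by rewrite /arr_center big_set0.
Qed.

Lemma arr_center_localization0 B : arr_center (localization B fullv) = fullv.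
Proof.
rewrite /arr_center big_pred0 // => H; rewrite inE; apply/negP => /andP[_ sVH].
case/negP: (alpha_neq0 H); apply/eqP/lfunP => v; rewrite zero_lfunE.
by apply/eqP; rewrite -memv_ker (subvP sVH) ?memvf.
Qed.

End Fixed.

(* The symmetric algebra of V^*, as the polynomial ring in the coordinates of the basis
   [vbasis fullv] of V. *)
Definition symdual := {mpoly K[\dim {:V}]}.

Definition sym_form (f : 'Hom(V, K^o)) : symdual :=
  \sum_(i < \dim {:V}) (f (vbasis {:V})`_i : K) *: 'X_i.

Definition derivation (theta : symdual -> symdual) : Prop :=
  (forall (a : K) p q, theta (a *: p + q) = a *: theta p + theta q) /\
  (forall p q, theta (p * q) = theta p * q + p * theta q).

(* The S-module D(A, m). *)
Definition logder (A : arrangement) (m : A -> nat)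
    (theta : symdual -> symdual) : Prop :=
  derivation theta /\
  forall H, exists q, theta (sym_form (alpha H)) = q * sym_form (alpha H) ^+ m H.

End Arrangements.

(* M, a submodule of the S-module of functions T -> S, has a basis. *)
Definition free_module (S : comNzRingType) (T : Type) (M : (T -> S) -> Prop) :
    Prop :=
  exists (I : eqType) (b : I -> T -> S),
  [/\ forall i, M (b i),
      forall theta, M theta -> exists (s : seq I) (c : I -> S),
        forall p, theta p = \sum_(i <- s) c i * b i p
    & forall (s : seq I) (c : I -> S), uniq s ->
        (forall p, \sum_(i <- s) c i * b i p = 0) ->
        forall i, i \in s -> c i = 0].

Definition free_multiarrangement (K : fieldType) (V : vectType K)
    (A : arrangement V) (m : A -> nat) : Prop :=
  @free_module (symdual V) (symdual V) (@logder K V A m).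

(* Main.v *)
Require Import Defs.
From HB Require Import structures.
From mathcomp Require Import all_boot all_order all_algebra.
From mathcomp Require Import mpoly zify.
From Stdlib Require Import Classical ClassicalEpsilon.

(** Why freeness forces total formality.

    Let S be the symmetric algebra of V*, realized as polynomials in l = dim V
    variables, and D(B) the submodule of S^l formed by the coefficient vectors
    of the logarithmic derivations of a subarrangement B.  Iterated cokernels
    D^1(B) = S^l / D(B) and
      D^(k+1)(B) = coker (D^k(B) -> sum of the D^k(B_Y), Y of rank k)
    are presented here as quotients of nested families of vectors by explicit
    submodules [log_rel].  The same recursion started from the center of B in V
    gives [const_rel], and the annihilator of that space is R_k(B)
    ([Rsub_perp], [const_rel_perp]).  So pi_k is onto as soon as an element of
    the constant ambient space that is a relation for every B_Y is a relation
    for B ([pi_surjectiveP]).  Constants embed in polynomials and evaluation at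
    0 is a retraction, which reduces this to the same statement over S: the map
    from D^k(B) to the sum of the D^k(B_Y), Y of rank k, is injective
    ([log_rel_locally]).

    Injectivity is a depth statement.  An element of the kernel is killed by
    products of the forms alpha_H with H outside B_Y, for every Y of rank k
    ([log_rel_away]).  If it is nonzero, some nonzero multiple is killed by
    k+1 independent forms ([log_rel_descent]).  This is impossible when the
    Koszul cohomology of D^k(B) with respect to independent forms f_1, ..., f_n
    vanishes in degrees below n - k.  Once injectivity is known at level k, the
    short exact sequence defining D^(k+1) shifts this vanishing from k to k+1
    ([exact_shift]), so both properties are proved together by induction
    ([exact_log_rel]).

    The induction starts from the vanishing for D(B) in degrees below n, where
    B is any localization, although only D(A) is assumed free.  A free module
    inherits vanishing from S ([exact_free]).  To pass to D(B), assume first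
    that the f_i vanish on the center of B.  A cocycle with values in D(B)
    becomes a coboundary after multiplication by a product of forms alpha_H, H
    not in B; each of these is nonzero at some vector y of the center, and
    dividing along y removes it ([divided_difference], [exact_central]).  In
    general, elementary operations on the list of forms separate those that
    vanish on the center from others that are independent on it, and the latter
    are added one at a time by the same division ([exact_local]).  Division along
    a vector takes the place of the passage to a generic point of the center,
    which need not be rational when the field is finite. *)

Set Implicit Arguments.
Unset Strict Implicit.
Unset Printing Implicit Defensive.

Import GRing.Theory.
Local Open Scope ring_scope.

Lemma skolem (X Y : Type) (P : X -> Y -> Prop) :
  (forall x, exists y, P x y) -> exists f, forall x, P x (f x).
Proof.
move=> exP; pose e x := constructive_indefinite_description _ (exP x).
by exists (fun x => proj1_sig (e x)) => x; apply: (proj2_sig (e x)).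
Qed.

(** * Koszul cohomology *)
Section Koszul.
Variables (S : comNzRingType) (U : lmodType S).
Implicit Types (fs gs ks : seq S) (c : bitseq -> U) (s : bitseq) (M N : U -> Prop).

Definition submodule N := N 0 /\ forall a x y, N x -> N y -> N (a *: x + y).

Lemma submod0 N : submodule N -> N 0.
Proof. by case. Qed.

Lemma submodD N x y : submodule N -> N x -> N y -> N (x + y).
Proof. by case=> _ H Nx Ny; have := H 1 x y Nx Ny; rewrite scale1r. Qed.

Lemma submodZ N a x : submodule N -> N x -> N (a *: x).
Proof. by case=> N0 H Nx; have := H a x 0 Nx N0; rewrite addr0. Qed.

Lemma submodN N x : submodule N -> N x -> N (- x).
Proof. by move=> sN Nx; rewrite -scaleN1r; apply: submodZ. Qed.

Lemma submodB N x y : submodule N -> N x -> N y -> N (x - y).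
Proof. by move=> sN Nx Ny; apply: submodD => //; apply: submodN. Qed.

Lemma submod_sum N (I : Type) (r : seq I) (P : pred I) (F : I -> U) :
  submodule N -> (forall i, P i -> N (F i)) -> N (\sum_(i <- r | P i) F i).
Proof.
move=> sN NF; elim/big_ind: _ => //; first exact: submod0.
by move=> x y; apply: submodD.
Qed.

Lemma submodule_zeromod : submodule (fun x => x = 0).
Proof. by split=> // a x y -> ->; rewrite scaler0 addr0. Qed.

(** The Koszul differential of the list [fs].  A cochain is indexed by bit
    sequences of length [size fs], a bit sequence standing for the wedge of the
    basis vectors at its true positions; cochains of all degrees live together,
    and the recursion is that of the mapping cone of multiplication by the head
    of the list. *)
Fixpoint koszul_d fs c s : U :=
  match fs, s with
  | f :: fs', b :: s' =>
      if b then f *: c (false :: s') - koszul_d fs' (fun t => c (true :: t)) s'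
      else koszul_d fs' (fun t => c (false :: t)) s'
  | _, _ => 0
  end.

Definition has_degree n i s := (size s == n) && (count id s == i).

Lemma has_degree_cons n i b s : has_degree n.+1 i (b :: s) =
  if b then (0 < i)%N && has_degree n i.-1 s else has_degree n i s.
Proof.
rewrite /has_degree /= eqSS; case: b => /=; last by rewrite add0n.
by case: i => [|i]; rewrite add1n ?andbF ?eqSS.
Qed.

Lemma koszul_d_deg0 fs c s : has_degree (size fs) 0 s -> koszul_d fs c s = 0.
Proof.
by elim: fs c s => [|f fs IH] c [|[] s] //=; rewrite has_degree_cons //; apply: IH.
Qed.

Lemma koszul_d_ext fs c (b : bitseq -> U) s :
  c =1 b -> koszul_d fs c s = koszul_d fs b s.
Proof.
elim: fs c b s => [|f fs IH] c b [|[] s] //= eq_cb; rewrite ?eq_cb.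
  by rewrite (IH _ (fun t => b (true :: t))).
by apply: IH.
Qed.

Lemma koszul_d_lin fs a c (b : bitseq -> U) s :
  koszul_d fs (fun t => a *: c t + b t) s = a *: koszul_d fs c s + koszul_d fs b s.
Proof.
elim: fs c b s => [|f fs IH] c b [|[] s] /=; rewrite ?scaler0 ?addr0 //.
rewrite (IH (fun t => c (true :: t)) (fun t => b (true :: t))) scalerDr opprD scalerBr.
by rewrite !scalerA (mulrC f a) addrACA.
Qed.

Lemma koszul_dD fs c (b : bitseq -> U) s :
  koszul_d fs (fun t => c t + b t) s = koszul_d fs c s + koszul_d fs b s.
Proof.
rewrite -[koszul_d fs c s]scale1r -koszul_d_lin; apply: koszul_d_ext => t.
by rewrite scale1r.
Qed.

Lemma koszul_dB fs c (b : bitseq -> U) s :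
  koszul_d fs (fun t => c t - b t) s = koszul_d fs c s - koszul_d fs b s.
Proof.
rewrite addrC -scaleN1r -koszul_d_lin; apply: koszul_d_ext => t.
by rewrite scaleN1r addrC.
Qed.

Lemma koszul_dZ fs a c s : koszul_d fs (fun t => a *: c t) s = a *: koszul_d fs c s.
Proof.
elim: fs c s => [|f fs IH] c [|[] s] /=; rewrite ?scaler0 //.
by rewrite (IH (fun t => c (true :: t))) scalerBr !scalerA mulrC.
Qed.

Lemma koszul_dN fs c s : koszul_d fs (fun t => - c t) s = - koszul_d fs c s.
Proof. by rewrite -scaleN1r -koszul_dZ; apply: koszul_d_ext => t; rewrite scaleN1r. Qed.

(** The component of degree i+1 of a differential involves only the components
    of degree i, so that membership in a submodule can be tested degreewise. *)
Lemma koszul_d_local N fs c i s : submodule N ->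
  (forall t, has_degree (size fs) i t -> N (c t)) ->
  has_degree (size fs) i.+1 s -> N (koszul_d fs c s).
Proof.
move=> sN; elim: fs c i s => [|f fs IH] c i [|[] s] Nc; rewrite /= ?has_degree_cons /=;
  try by move=> *; apply: submod0.
  move=> ds; apply: submodB => //.
    by apply: submodZ => //; apply: Nc; rewrite has_degree_cons.
  case: i Nc ds => [|i] Nc ds; first by rewrite koszul_d_deg0 //; apply: submod0.
  by apply: (IH _ i) => // t dt; apply: Nc; rewrite has_degree_cons.
by apply: IH => t dt; apply: Nc; rewrite has_degree_cons.
Qed.

Lemma koszul_d_eq fs c (b : bitseq -> U) i s : has_degree (size fs) i.+1 s ->
  (forall t, has_degree (size fs) i t -> c t = b t) ->
  koszul_d fs c s = koszul_d fs b s.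
Proof.
move=> ds eq_cb; apply/eqP; rewrite -subr_eq0 -koszul_dB; apply/eqP.
apply: (koszul_d_local (N := fun x => x = 0) _ _ ds); first exact: submodule_zeromod.
by move=> t dt; rewrite eq_cb ?subrr.
Qed.

Lemma koszul_d_all N fs c s : submodule N -> (forall t, N (c t)) -> N (koszul_d fs c s).
Proof.
move=> sN; elim: fs c s => [|f fs IH] c [|[] s] Nc /=; try exact: submod0.
  by apply: submodB; [|apply: submodZ|apply: IH].
exact: IH.
Qed.

Lemma koszul_dd fs c s : koszul_d fs (koszul_d fs c) s = 0.
Proof.
elim: fs c s => [|f fs IH] c [|[] s] //=; rewrite (koszul_dB, IH) /=.
by rewrite koszul_dZ IH subr0 subrr.
Qed.

Lemma koszul_d_comm fs (q : U -> U) c s :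
  {morph q : x y / x - y} ->
  {in fs, forall f x, q (f *: x) = f *: q x} ->
  q (koszul_d fs c s) = koszul_d fs (q \o c) s.
Proof.
move=> qB; have q0 : q 0 = 0 by have := qB 0 0; rewrite !subrr.
elim: fs c s => [|f fs IH] c [|[] s] qf //=.
  rewrite qB qf ?mem_head // IH // => g fs_g; apply: qf; exact: mem_behead.
by rewrite IH // => g fs_g; apply: qf; exact: mem_behead.
Qed.

(** Vanishing of the cohomology in degree [i] with coefficients in the quotient
    of [M] by its intersection with [N].  Two cases matter: [M] everything, for
    a quotient module, and [N] zero, for a submodule. *)
Definition koszul_exact fs i M N := forall c,
  (forall s, M (c s)) ->
  (forall s, has_degree (size fs) i.+1 s -> N (koszul_d fs c s)) ->
  exists2 b, forall s, M (b s) &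
    forall s, has_degree (size fs) i s -> N (c s - koszul_d fs b s).

Definition zeromod (x : U) := x = 0.
Definition fullmod (x : U) := True.

(* contraction by ks *)
(** Interior product with the covector of coordinates [ks]. *)
Fixpoint contraction ks c s : U :=
  match ks, s with
  | k :: ks', b :: s' =>
      if b then - contraction ks' (fun t => c (true :: t)) s'
      else k *: c (true :: s') + contraction ks' (fun t => c (false :: t)) s'
  | _, _ => 0
  end.

Fixpoint dot_seq ks fs : S :=
  match ks, fs with k :: ks', f :: fs' => k * f + dot_seq ks' fs' | _, _ => 0 end.

Lemma contraction_ext ks c (b : bitseq -> U) s :
  c =1 b -> contraction ks c s = contraction ks b s.
Proof.
elim: ks c b s => [|f fs IH] c b [|[] s] //= eq_cb; rewrite ?eq_cb.
  by rewrite (IH _ (fun t => b (true :: t))).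
by rewrite (IH _ (fun t => b (false :: t))).
Qed.

Lemma contraction_lin ks a c (b : bitseq -> U) s :
  contraction ks (fun t => a *: c t + b t) s =
  a *: contraction ks c s + contraction ks b s.
Proof.
elim: ks c b s => [|k ks IH] c b [|[] s] /=; rewrite ?scaler0 ?addr0 //.
  by rewrite (IH (fun t => c (true :: t)) (fun t => b (true :: t))) opprD scalerN.
rewrite (IH (fun t => c (false :: t)) (fun t => b (false :: t))) !scalerDr !scalerA.
by rewrite (mulrC k a) addrACA.
Qed.

Lemma contraction_local N ks c i s : submodule N ->
  (forall t, has_degree (size ks) i.+1 t -> N (c t)) ->
  has_degree (size ks) i s -> N (contraction ks c s).
Proof.
move=> sN; elim: ks c i s => [|f fs IH] c i [|[] s] Nc; rewrite /= ?has_degree_cons /=;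
  try by move=> *; apply: submod0.
  case: i Nc => [|i] Nc //= ds; apply: submodN => //.
  by apply: (IH _ i) => // t dt; apply: Nc; rewrite has_degree_cons.
move=> ds; apply: submodD => //.
  by apply: submodZ => //; apply: Nc; rewrite has_degree_cons.
by apply: (IH _ i) => // t dt; apply: Nc; rewrite has_degree_cons.
Qed.

Lemma contraction_all N ks c s :
  submodule N -> (forall t, N (c t)) -> N (contraction ks c s).
Proof.
move=> sN; elim: ks c s => [|f fs IH] c [|[] s] Nc /=; try exact: submod0.
  by apply: submodN; last apply: IH.
by apply: submodD; [|apply: submodZ|apply: IH].
Qed.

Lemma contractionBZ ks f c (b : bitseq -> U) s :
  contraction ks (fun t => f *: c t - b t) s =
  f *: contraction ks c s - contraction ks b s.
Proof.
have E : contraction ks (fun t => - b t) s = - contraction ks b s.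
  have := contraction_lin ks (-1) b (fun=> 0) s.
  have -> : contraction ks (fun=> 0) s = 0.
    by apply: (contraction_all (N := zeromod)) => //; exact: submodule_zeromod.
  by rewrite addr0 scaleN1r => <-; apply: contraction_ext => t; rewrite scaleN1r addr0.
by rewrite -E -contraction_lin.
Qed.

(** Cartan's formula: a linear combination of the [fs] acts on the Koszul complex
    by a map homotopic to zero. *)
Lemma koszul_homotopy ks fs c s : size ks = size fs -> size s = size fs ->
  koszul_d fs (contraction ks c) s + contraction ks (koszul_d fs c) s =
  dot_seq ks fs *: c s.
Proof.
elim: fs ks c s => [|f fs IH] [|k ks] c [|[] s] //=; rewrite ?scale0r ?addr0 //.
  move=> [sk] [ss]; rewrite contractionBZ.
  rewrite (koszul_dN fs (contraction ks (fun t => c (true :: t)))).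
  rewrite scalerDl -(IH ks (fun t => c (true :: t))) // scalerDr scalerA (mulrC f k).
  rewrite opprK opprB -!addrA; congr (_ + _).
  by rewrite addrC -!addrA addNr addr0.
move=> [sk] [ss]; rewrite koszul_d_lin scalerDl -(IH ks (fun t => c (false :: t))) //.
rewrite scalerBr scalerA addrC -!addrA; congr (_ + _).
by rewrite [X in _ + X]addrCA addKr addrC.
Qed.

(** Cochain maps compatible with every choice of coefficients: an operator given
    by fixed scalar combinations of components preserves all submodules,
    globally and in each degree, and this is all that exactness needs. *)
Record koszul_map fs gs (T : (bitseq -> U) -> bitseq -> U) : Prop := KoszulMap {
  koszul_map_lin : forall a c (b : bitseq -> U) s,
    T (fun t => a *: c t + b t) s = a *: T c s + T b s;
  koszul_map_local : forall N c i s, submodule N ->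
    (forall t, has_degree (size fs) i t -> N (c t)) ->
    has_degree (size gs) i s -> N (T c s);
  koszul_map_all : forall N c s, submodule N -> (forall t, N (c t)) -> N (T c s);
  koszul_map_d : forall c s, size s = size gs ->
    T (koszul_d fs c) s = koszul_d gs (T c) s
}.

Definition koszul_equiv fs gs := exists T T',
  [/\ koszul_map fs gs T, koszul_map gs fs T' &
      forall c s, size s = size gs -> T (T' c) s = c s].

Lemma koszul_mapB fs gs T c (b : bitseq -> U) s : koszul_map fs gs T ->
  T (fun t => c t - b t) s = T c s - T b s.
Proof.
move=> kT; have E d d' : d =1 d' -> T d s = T d' s.
  move=> dd; apply/eqP; rewrite -subr_eq0 -scaleN1r addrC -(koszul_map_lin kT).
  apply/eqP/(koszul_map_all kT (N := zeromod)) => [|t].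
    exact: submodule_zeromod.
  by rewrite dd scaleN1r addNr.
by rewrite addrC -scaleN1r -(koszul_map_lin kT); apply: E => t; rewrite scaleN1r addrC.
Qed.

Lemma koszul_equiv_exact fs gs i M N : submodule M -> submodule N ->
  koszul_equiv fs gs -> koszul_exact fs i M N -> koszul_exact gs i M N.
Proof.
move=> sM sN [T [T' [kT kT' TT']]] ex c Mc Nc.
have [||b Mb Nb] := ex (T' c).
- by move=> s; apply: (koszul_map_all kT').
- move=> s ds; rewrite -(koszul_map_d kT'); last by case/andP: ds => /eqP.
  exact: (koszul_map_local kT' sN Nc).
exists (T b) => [s|s ds]; first exact: (koszul_map_all kT).
have ss : size s = size gs by case/andP: ds => /eqP.
rewrite -(TT' c) // -(koszul_map_d kT) // -(koszul_mapB _ _ _ kT).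
exact: (koszul_map_local kT sN Nb).
Qed.

Lemma koszul_equiv_cons f fs gs : size fs = size gs ->
  koszul_equiv fs gs -> koszul_equiv (f :: fs) (f :: gs).
Proof.
move=> eqs [T [T' [kT kT' TT']]].
pose L (T : (bitseq -> U) -> bitseq -> U) (c : bitseq -> U) (s : bitseq) :=
  if s is b :: s' then T (fun t => c (b :: t)) s' else 0.
have kL hs ks A : koszul_map hs ks A -> koszul_map (f :: hs) (f :: ks) (L A).
  move=> kA; split.
  - move=> a c d [|b s] /=; first by rewrite scaler0 addr0.
    exact: (koszul_map_lin kA).
  - move=> N c i [|b s] sN Nc; first by move=> _; apply: submod0.
    rewrite /= has_degree_cons; case: b => [|] ds /=.
      case: i ds Nc => //= i ds Nc; apply: (koszul_map_local kA sN _ ds) => t dt.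
      by apply: Nc; rewrite has_degree_cons.
    by apply: (koszul_map_local kA sN _ ds) => t dt; apply: Nc; rewrite has_degree_cons.
  - move=> N c [|b s] sN Nc /=; first exact: submod0.
    exact: (koszul_map_all kA).
  - move=> c [|[] s] //= [ss]; last exact: (koszul_map_d kA).
    rewrite (koszul_mapB _ _ _ kA) (koszul_map_d kA) //; congr (_ - _).
    pose z : bitseq -> U := fun=> 0.
    have Az : A z s = 0.
      by apply: (koszul_map_all kA (N := zeromod)) => //; exact: submodule_zeromod.
    have := koszul_map_lin kA f (fun t => c (false :: t)) z s; rewrite Az addr0 => <-.
    apply/eqP; rewrite -subr_eq0 -(koszul_mapB _ _ _ kA).
    apply/eqP/(koszul_map_all kA (N := zeromod)) => [|t].
      exact: submodule_zeromod.
    by rewrite /z /zeromod addr0 subrr.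
exists (L T), (L T'); split; [exact: kL|exact: kL|].
by move=> c [|b s] //= [ss]; rewrite -[RHS](TT' (fun t => c (b :: t))).
Qed.

Lemma koszul_equiv_cat hs fs gs : size fs = size gs -> koszul_equiv fs gs ->
  koszul_equiv (hs ++ fs) (hs ++ gs).
Proof.
move=> eqs eq_fg; elim: hs => //= h hs IH.
by apply: koszul_equiv_cons => //; rewrite !size_cat eqs.
Qed.

Lemma koszul_equiv_swap f g fs : koszul_equiv [:: f, g & fs] [:: g, f & fs].
Proof.
pose T (c : bitseq -> U) (s : bitseq) := match s with
  | b1 :: b2 :: s' => if b1 && b2 then - c s else c [:: b2, b1 & s']
  | _ => 0 end.
have kT f' g' : koszul_map [:: f', g' & fs] [:: g', f' & fs] T.
  split.
  - move=> a c d [|b1 [|b2 s]] /=; rewrite ?scaler0 ?addr0 //.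
    by case: ifP => // _; rewrite opprD scalerN.
  - move=> N c i [|b1 [|b2 s]] sN Nc /=; try by move=> _; apply: submod0.
    rewrite /has_degree /= => ds.
    case: ifP => _; first by apply: submodN => //; apply: Nc.
    by apply: Nc; rewrite /has_degree /= addnCA.
  - move=> N c [|b1 [|b2 s]] sN Nc /=; try exact: submod0.
    by case: ifP => // _; apply: submodN.
  - move=> c [|[] [|[] s]] //= [ss].
    + rewrite (koszul_dN fs (fun t => c [:: true, true & t])).
      by rewrite opprB opprK opprD addrA addrAC.
exists T, T; split=> // c [|[] [|[] s]] //= _; exact: opprK.
Qed.

(** Adding to the head a combination of the tail changes the cone by a homotopy,
    and a homotopy between two maps gives an isomorphism of their cones. *)
Lemma koszul_equiv_head (f : S) ks fs : size ks = size fs ->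
  koszul_equiv (f :: fs) (f + dot_seq ks fs :: fs).
Proof.
move=> sk.
pose T (e : S) (c : bitseq -> U) (s : bitseq) :=
  if s is b :: s' then
    c s + (if b then e *: contraction ks (fun t => c (false :: t)) s' else 0)
  else 0.
have kT f' (e' : S) : koszul_map (f' :: fs) (f' + e' * dot_seq ks fs :: fs) (T e').
  split.
  - move=> a c d [|[] s] /=; rewrite ?scaler0 ?addr0 //.
    rewrite (contraction_lin _ _ (fun t => c (false :: t)) (fun t => d (false :: t))).
    by rewrite !scalerDr !scalerA (mulrC e' a) addrACA.
  - move=> N c i [|[] s] sN Nc; try by move=> *; apply: submod0.
      move=> ds; apply: submodD => //; first exact: Nc.
      apply: submodZ => //; move: ds; rewrite /= has_degree_cons -sk.
      case: i Nc => //= i Nc; apply: contraction_local => // t dt.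
      by apply: Nc; rewrite has_degree_cons /= -sk.
    by move=> ds; rewrite /= addr0; apply: Nc.
  - move=> N c [|[] s] sN Nc /=; try exact: submod0; last by rewrite addr0.
    by apply: submodD => //; apply: submodZ => //; apply: contraction_all.
  - move=> c [|[] s] //= [ss]; last first.
      by rewrite addr0; apply: koszul_d_ext => t; rewrite addr0.
    rewrite addr0 scalerDl -scalerA -(koszul_homotopy (fun t => c (false :: t)) sk) //.
    rewrite koszul_dD koszul_dZ scalerDr opprD -!addrA; congr (_ + _).
    by rewrite [RHS]addrC -!addrA addNr addr0 addrC.
exists (T 1), (T (-1)); split.
- by have := kT f 1; rewrite mul1r.
- have := kT (f + dot_seq ks fs) (-1).
  by rewrite mulN1r addrK.
move=> c [|[] s] //= _; rewrite ?addr0 // scaleN1r scale1r -addrA.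
have E : (fun t => c (false :: t) + 0) =1 (fun t => c (false :: t)).
  by move=> t; rewrite addr0.
by rewrite (contraction_ext _ _ E) addNr addr0.
Qed.

Lemma exact_move_head i M N f fs gs : submodule M -> submodule N ->
  koszul_exact (fs ++ f :: gs) i M N -> koszul_exact (f :: fs ++ gs) i M N.
Proof.
move=> sM sN; elim/last_ind: fs gs => [|fs g IH] gs //.
rewrite !cat_rcons => ex; apply: IH; apply: koszul_equiv_exact ex => //.
exact/koszul_equiv_cat/koszul_equiv_swap.
Qed.

(** [q] divides by [x] and is linear over the other elements of the list, as does
    p |-> (p - p(x = 0)) / x on a polynomial ring in which the [fs] do not
    involve x. *)
Definition quotient_op x fs M (q : U -> U) :=
  [/\ {morph q : u v / u - v}, forall u, q (x *: u) = u,
      {in fs, forall f u, q (f *: u) = f *: q u} & forall u, M u -> M (q u)].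

(** [q] carries a primitive of [x *: c] to one of [c]: [x] is a nonzerodivisor
    modulo coboundaries. *)
Lemma quotient_koszul_d x fs M q c b i : quotient_op x fs M q ->
  (forall s, has_degree (size fs) i s -> x *: c s = koszul_d fs b s) ->
  forall s, has_degree (size fs) i s -> c s = koszul_d fs (q \o b) s.
Proof. by case=> qB qx qf _ xc s ds; rewrite -(koszul_d_comm _ _ qB qf) -xc // qx. Qed.

(** Adding an element by which one can divide raises the range of vanishing by
    one: a cocycle (a, b) of the cone has x a = d b, whence a = d (q b), and then
    b - x (q b) is a cocycle of the smaller complex. *)
Lemma exact_cons x fs i M q : submodule M -> quotient_op x fs M q ->
  ((0 < i)%N -> koszul_exact fs i.-1 M zeromod) ->
  koszul_exact (x :: fs) i M zeromod.
Proof.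
move=> sM qop ex c Mc c0.
pose c_ b t : U := c (b :: t); case: (qop) => _ _ _ qM.
have c_q s : has_degree (size fs) i s -> c_ false s = koszul_d fs (q \o c_ true) s.
  apply: (quotient_koszul_d (b := c_ true) qop) => {}s ds.
  by apply/eqP; rewrite -subr_eq0; apply/eqP/(c0 (true :: s)); rewrite has_degree_cons.
have [e Me ec] : exists2 e : bitseq -> U, (forall s, M (e s)) &
    (0 < i)%N -> forall s, has_degree (size fs) i.-1 s ->
    c_ true s - x *: q (c_ true s) = koszul_d fs e s.
  case: i ex c0 c_q => [|i] ex c0 c_q /=.
    by exists (fun=> 0) => // _; apply: submod0.
  have [s|s ds|e Me ec] := ex isT (fun s => c_ true s - x *: q (c_ true s)).
  - by apply: submodB (Mc _) _ => //; apply: submodZ (qM _ (Mc _)).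
  - rewrite /zeromod koszul_dB koszul_dZ -/(q \o c_ true) -c_q //.
    rewrite -[X in X - _]opprK -opprD.
    have := c0 (true :: s); rewrite has_degree_cons /= => /(_ ds) E.
    by rewrite -[RHS]oppr0 -E addrC.
  by exists e => // _ s ds; apply/eqP; rewrite -subr_eq0; apply/eqP/ec.
exists (fun s => if s is b :: s' then if b then - e s' else q (c_ true s') else 0).
  move=> [|[] s]; [exact: submod0 | exact: submodN | exact: qM (Mc _)].

case=> [|[] s] //; rewrite has_degree_cons /zeromod /=.
  case/andP=> i_gt0 ds; apply/eqP; rewrite subr_eq0; apply/eqP.
  by rewrite koszul_dN opprK -ec // addrC subrK.
by move=> ds; rewrite -[c _]/(c_ false s) c_q // subrr.
Qed.

(** The long exact sequence of D -> U -> U / D. *)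
Lemma exact_quotient fs i D : submodule D ->
  koszul_exact fs i.+1 D zeromod -> koszul_exact fs i fullmod zeromod ->
  koszul_exact fs i fullmod D.
Proof.
move=> sD exD ex c _ Dc.
(* [d c] truncated to degree i+1, where alone it is known to lie in [D]. *)
pose c' s := if has_degree (size fs) i.+1 s then koszul_d fs c s else 0.
have [s|s ds|w Dw Ew] := exD c'.
- by rewrite /c'; case: ifP => [/Dc //|_]; apply: submod0.
- rewrite /zeromod -(koszul_dd fs c s); apply: (koszul_d_eq ds) => t dt.
  by rewrite /c' dt.
have [//|s ds|b _ Eb] := ex (fun s => c s - w s).
  by rewrite /zeromod koszul_dB -[RHS](Ew s ds) /c' ds.
exists b => // s ds; have /eqP := Eb s ds; rewrite addrAC subr_eq0 => /eqP ->.
exact: Dw.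
Qed.
End Koszul.

Section FreeModule.
Variables (S : comNzRingType) (U : lmodType S) (I : eqType) (beta : I -> U).

Lemma lincomb_widen (r0 r : seq I) (a : I -> S) : uniq r -> {subset r0 <= r} ->
  \sum_(j <- r0) a j *: beta j = \sum_(j <- r) (\sum_(k <- r0 | k == j) a k) *: beta j.
Proof.
move=> r_uniq; elim: r0 => [|k r0 IH] sub.
  by rewrite big_nil big1 // => j _; rewrite big_nil scale0r.
rewrite big_cons IH => [|j r0j]; last by apply: sub; rewrite inE r0j orbT.
have rk : k \in r by apply: sub; rewrite mem_head.
rewrite !(bigD1_seq k) //= big_cons eqxx scalerDl addrA; congr (_ + _).
by apply: eq_bigr => j /negPf nj; rewrite big_cons eq_sym nj.
Qed.

Lemma koszul_d_scale (fs : seq S) (c : bitseq -> S) (u : U) s :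
  koszul_d fs (fun t => c t *: u) s = @koszul_d S S^o fs c s *: u.
Proof.
elim: fs c s => [|f fs IH] c [|[] s] /=; rewrite ?scale0r //.
by rewrite (IH (fun t => c (true :: t))) scalerBl scalerA.
Qed.

(** The basis may be infinite, but a cochain has finitely many components, so
    only finitely many basis elements occur and one solves coordinate by
    coordinate. *)
Lemma exact_free (fs : seq S) i (D : U -> Prop) :
  submodule D -> (forall j, D (beta j)) ->
  (forall u, D u -> exists r (a : I -> S), u = \sum_(j <- r) a j *: beta j) ->
  (forall r (a : I -> S), uniq r -> \sum_(j <- r) a j *: beta j = 0 ->
     forall j, j \in r -> a j = 0) ->
  koszul_exact fs i (@fullmod S S^o) (@zeromod S S^o) ->
  koszul_exact fs i D (@zeromod S U).
Proof.
move=> sD Db span_b free_b ex c Dc c0.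
have sum_d r (a : bitseq -> I -> S) s :
    koszul_d fs (fun t => \sum_(j <- r) a t j *: beta j) s =
    \sum_(j <- r) @koszul_d S S^o fs (a^~ j) s *: beta j.
  elim: r => [|j r IH].
    rewrite big_nil; apply: (koszul_d_all (N := @zeromod S U)).
      exact: submodule_zeromod.
    by move=> t; rewrite big_nil.
  rewrite big_cons -IH -koszul_d_scale -koszul_dD; apply: koszul_d_ext => t.
  by rewrite big_cons.
have [r [r_uniq [a ca]]] : exists r : seq I, uniq r /\ exists a : bitseq -> I -> S,
    forall s, size s = size fs -> c s = \sum_(j <- r) a s j *: beta j.
  have /skolem [r Hr] := fun s => span_b _ (Dc s).
  (* [rr] collects the basis elements needed for the finitely many components. *)
  pose rr := undup (flatten [seq r (val t) | t : (size fs).-tuple bool]).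
  exists rr; split; first exact: undup_uniq.
  have [a Ha] := skolem Hr; exists (fun s j => \sum_(k <- r s | k == j) a s k).
  move=> s ss; rewrite Ha; apply: lincomb_widen; first exact: undup_uniq.
  move=> j rj; rewrite mem_undup; apply/flattenP; exists (r s) => //.
  by have /eqP st := ss; apply/mapP; exists (Tuple st); rewrite ?mem_enum.
have a0 j s : j \in r -> has_degree (size fs) i.+1 s ->
    @koszul_d S S^o fs (a^~ j) s = 0.
  move=> rj ds; apply: (free_b r (fun j => @koszul_d S S^o fs (a^~ j) s)) => //.
  rewrite -sum_d; apply: etrans (c0 s ds).
  apply: (koszul_d_eq ds) => t /andP[/eqP st _].
  by rewrite ca.
have /skolem [b Hb] : forall j, exists b : bitseq -> S, j \in r ->
    forall s, has_degree (size fs) i s -> a s j - @koszul_d S S^o fs b s = 0.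
  move=> j; case rj : (j \in r); last by exists (fun=> 0).
  have [//|s ds|b _ Hb] := ex (a^~ j); first exact: a0.
  by exists b => _; apply: Hb.
exists (fun s => \sum_(j <- r) b j s *: beta j).
  by move=> s; apply: submod_sum => // j _; apply: submodZ.
move=> s ds; rewrite /zeromod (sum_d r (fun s j => b j s)) ca; last first.
  by case/andP: ds => /eqP.
rewrite -sumrB big_seq big1 // => j rj.
by rewrite -scalerBl (Hb j rj s ds) scale0r.
Qed.
End FreeModule.

(** * Division along a vector *)
Section LinearForms.
Variable K : fieldType.

Lemma separate_vspace (W : vectType K) (P : {vspace W}) w : w \notin P ->
  exists l : 'Hom(W, K^o), l w = 1 /\ {in P, forall g, l g = 0}.
Proof.
move=> Pw; pose p : 'End(W) := \1%VF - projv P.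
have pE g : p g = g - projv P g by rewrite /p add_lfunE opp_lfunE id_lfunE.
have [i ci] : exists i, coord (vbasis {:W}) i (p w) != 0.
  apply/existsP; apply: contraR Pw; rewrite negb_exists => /forallP c0.
  have pw0 : p w = 0.
    rewrite (coord_vbasis (memvf (p w))) big1 // => i _.
    by have := c0 i; rewrite negbK => /eqP ->; rewrite scale0r.
  by move/eqP: pw0; rewrite pE subr_eq0 => /eqP ->; apply: memv_proj.
pose ci' : 'Hom(W, K^o) := linfun (coord (vbasis {:W}) i : W -> K^o).
pose l : 'Hom(W, K^o) := ((coord (vbasis {:W}) i (p w))^-1 *: (ci' \o p))%VF.
have lE g : l g = (coord (vbasis {:W}) i (p w))^-1 * coord (vbasis {:W}) i (p g).
  by rewrite /l scale_lfunE comp_lfunE [X in _ *: X]lfunE.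
exists l; split=> [|g Pg]; first by rewrite lE mulVf.
by rewrite lE (pE g) projv_id // subrr linear0 mulr0.
Qed.

Variable V : vectType K.
Local Notation n := (\dim {:V}).
Local Notation S := {mpoly K[n]}.
Local Notation form := 'Hom(V, K^o).
Local Notation e := (vbasis {:V}).

Lemma form_coord (f : form) v : f v = \sum_i coord e i v * f e`_i.
Proof.
rewrite {1}(coord_vbasis (memvf v)) linear_sum; apply: eq_bigr => i _.
by rewrite linearZ.
Qed.

(** Functionals on V* are evaluations at vectors of V. *)
Lemma form_functional (l : 'Hom(form, K^o)) : exists v, forall f : form, l f = f v.
Proof.
pose d i : form := linfun (coord e i : V -> K^o).
exists (\sum_i l (d i) *: e`_i) => f.
have -> : f = \sum_(i < n) f e`_i *: d i.
  apply/lfunP => v; rewrite sum_lfunE form_coord; apply: eq_bigr => i _.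
  by rewrite scale_lfunE lfunE /= mulrC.
rewrite !linear_sum; apply: eq_bigr => i _.
rewrite !linearZ /= sum_lfunE (bigD1 i) //= big1 => [|j /negPf ij].
  rewrite scale_lfunE lfunE /= coord_free ?eqxx ?(basis_free (vbasisP _)) //.
  by rewrite addr0 /GRing.scale /= mulr1 mulrC.
rewrite scale_lfunE lfunE /= coord_free ?(basis_free (vbasisP _)) //.
by rewrite eq_sym in ij; rewrite ij scaler0.
Qed.

Lemma separate_forms (P : {vspace form}) f : f \notin P ->
  exists y, f y = 1 /\ {in P, forall g : form, g y = 0}.
Proof.
case/separate_vspace => l [lf lP]; have [y ly] := form_functional l.
by exists y; split=> [|g Pg]; rewrite -ly // lP.
Qed.

Lemma sym_form_is_linear : linear (@sym_form K V : form -> S).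
Proof.
move=> a f g; rewrite /sym_form scaler_sumr -big_split /=; apply: eq_bigr => i _.
by rewrite add_lfunE scale_lfunE scalerDl scalerA.
Qed.

HB.instance Definition _ := GRing.isLinear.Build K form S *:%R
  (@sym_form K V : form -> S) sym_form_is_linear.

Lemma meval_sym_form (f : form) v :
  (sym_form f : S).@[fun i => coord e i v] = f v.
Proof.
rewrite /sym_form raddf_sum form_coord; apply: eq_bigr => i _ /=.
by rewrite mevalZ mevalXU mulrC.
Qed.

(** [q p] is (p - p o rho) / x, where rho is the projection of V onto the kernel
    of x parallel to y: p and p o rho agree on that kernel, hence the division,
    and rho fixes the forms that vanish at y.  On derivations the operator is
    applied to coefficients, and it preserves divisibility by powers of forms
    that vanish at y. *)
Lemma divided_difference (x : form) y : x y = 1 -> exists q : S -> S,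
  [/\ linear q, forall p, q (sym_form x * p) = p &
      forall (f : form) p, f y = 0 -> q (sym_form f * p) = sym_form f * q p].
Proof.
move=> xy1; pose X : S := sym_form x.
have X0 : X != 0.
  apply: contra_eq_neq xy1 => X0; rewrite -meval_sym_form -/X X0 meval0 eq_sym.
  exact: oner_neq0.
(* [lq] lists the coordinate functions composed with the projection rho. *)
pose lq := [tuple 'X_i - coord e i y *: X | i < n].
have lqE (i : 'I_n) : lq`_i = 'X_i - coord e i y *: X.
  by rewrite -tnth_nth tnth_mktuple.
pose rho : S -> S := comp_mpoly lq.
have rho_form f : rho (sym_form f) = sym_form f - f y *: X.
  rewrite /rho /sym_form raddf_sum form_coord scaler_suml -sumrB.
  apply: eq_bigr => i _ /=; rewrite comp_mpolyZ comp_mpolyXU lqE.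
  by rewrite scalerBr scalerA mulrC.
have /skolem [q qE] : forall p, exists h, p - rho p = X * h.
  pose P (p : S) := exists h, p - rho p = X * h.
  have P1 : P 1 by exists 0; rewrite /rho comp_mpoly1 subrr mulr0.
  have PM p r : P p -> P r -> P (p * r).
    move=> [h Eh] [k Ek]; exists (h * r + rho p * k).
    rewrite mulrDr mulrA -Eh mulrCA -Ek {1}/rho rmorphM /= -/rho.
    by rewrite mulrBl mulrBr addrA subrK.
  suff HP p : P p by [].
  elim/mpolyind: p => [|c m p _ _ [h Eh]].
    by exists 0; rewrite /rho comp_mpoly0 subrr mulr0.
  have [k Ek] : P 'X_[m].
    rewrite mpolyXE_id; apply: (big_ind P) => // i _.
    elim: (m i) => [|j IH]; first by rewrite expr0.
    rewrite exprS; apply: PM => //; exists (coord e i y)%:MP.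
    rewrite /rho comp_mpolyXU lqE opprB addrC subrK.
    by rewrite mulrC mul_mpolyC.
  exists (c *: k + h); rewrite mulrDr -Eh -scalerAr -Ek /rho.
  by rewrite comp_mpolyD comp_mpolyZ scalerBr opprD addrACA.
have XI := mulfI X0.
exists q; split.
- move=> a p r; apply: XI; rewrite mulrDr -scalerAr -!qE /rho.
  by rewrite comp_mpolyD comp_mpolyZ scalerBr opprD addrACA.
- move=> p; apply: XI; rewrite -qE /rho rmorphM /= -/rho rho_form xy1.
  by rewrite scale1r subrr mul0r subr0.
- move=> f p fy0; apply: XI; rewrite mulrCA -!qE /rho rmorphM /= -/rho rho_form fy0.
  by rewrite scale0r subr0 mulrBr.
Qed.

Section LogVectors.
Variables (A : arrangement V) (m : A -> nat).
Implicit Types (B : {set A}).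

Lemma mem_arr_center B v :
  reflect (forall H, H \in B -> alpha H v = 0) (v \in arr_center B).
Proof.
apply: (iffP idP) => [Bv H BH | Bv].
  apply/eqP; rewrite -memv_ker; apply: subvP Bv.
  by rewrite /arr_center; apply: bigcapv_inf (subvv _).
rewrite memvE; apply/subv_bigcapP => H BH.
by rewrite -memvE memv_ker; apply/eqP/Bv.
Qed.

Definition poly_vecs : lmodType S := {ffun 'I_n -> S^o}.

Definition apply_form (f : form) (t : poly_vecs) : S :=
  \sum_(i < n) f e`_i *: (t i : S).

Lemma apply_formP f a t u :
  apply_form f (a *: t + u) = a * apply_form f t + apply_form f u.
Proof.
rewrite /apply_form mulr_sumr -big_split; apply: eq_bigr => i _ /=.
by rewrite !ffunE scalerDr -scalerAr.
Qed.

Definition logvec B (t : poly_vecs) : Prop :=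
  forall H, H \in B -> exists h, apply_form (alpha H) t = h * sym_form (alpha H) ^+ m H.

Lemma submodule_logvec B : submodule (logvec B).
Proof.
split=> [H _|a t u Dt Du H BH].
  exists 0; rewrite mul0r /apply_form big1 // => i _; by rewrite ffunE scaler0.
have [h Eh] := Dt _ BH; have [k Ek] := Du _ BH; exists (a * h + k).
by rewrite apply_formP Eh Ek mulrDl mulrA.
Qed.

Lemma quotient_logvec B (x : form) y (fs : seq form) : x y = 1 -> y \in arr_center B ->
  {in fs, forall f : form, f y = 0} ->
  exists q, quotient_op (sym_form x) (map (@sym_form K V) fs) (logvec B) q.
Proof.
move=> xy1 By fsy; have [q [q_lin qx qf]] := divided_difference xy1.
have q0 : q 0 = 0 by have := q_lin (-1) 0 0; rewrite scaler0 addr0 scaleN1r addNr.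
have qD p r : q (p + r) = q p + q r by have := q_lin 1 p r; rewrite !scale1r.
have qZ a p : q (a *: p) = a *: q p by have := q_lin a p 0; rewrite q0 !addr0.
have qB p r : q (p - r) = q p - q r by rewrite addrC -scaleN1r q_lin scaleN1r addrC.
exists (fun t : poly_vecs => [ffun i => q (t i)] : poly_vecs); split.
- by move=> u v; apply/ffunP => i; rewrite !ffunE qB.
- by move=> u; apply/ffunP => i; rewrite !ffunE; apply: qx.
- by move=> _ /mapP[f fs_f ->] u; apply/ffunP => i; rewrite !ffunE; apply/qf/fsy.
- move=> t Dt H BH; have [h Eh] := Dt _ BH; exists (q h).
  have aHy : alpha H y = 0 by move/mem_arr_center: By; apply.
  have -> : apply_form (alpha H) [ffun i => q (t i)] = q (apply_form (alpha H) t).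
    rewrite /apply_form (big_morph q qD q0); apply: eq_bigr => i _.
    by rewrite ffunE qZ.
  rewrite Eh; elim: (m H) h {Eh} => [|k IH] h; first by rewrite !expr0 !mulr1.
  by rewrite exprS mulrCA qf // IH mulrCA.
Qed.

(** Independent linear forms are a regular sequence: the dual basis supplies the
    vectors along which to divide. *)
Lemma exact_poly (fs : seq form) i : free fs -> (i < size fs)%N ->
  koszul_exact (map (@sym_form K V) fs) i (@fullmod S S^o) (@zeromod S S^o).
Proof.
elim: fs i => [|x fs IH] i //=; rewrite free_cons => /andP[xfs fs_free] i_lt.
have [y [xy fy]] := separate_forms xfs.
have [q [q_lin qx qf]] := divided_difference xy.
apply: (@exact_cons S S^o _ _ _ _ q) => //; last first.
  by move=> i0; apply: IH => //; case: i i0 i_lt.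
have qB p r : q (p - r) = q p - q r.
  by rewrite addrC -scaleN1r q_lin scaleN1r addrC.
split=> //.
by move=> _ /mapP[f fs_f ->] u; apply/qf/fy/memv_span.
Qed.

End LogVectors.
End LinearForms.

(** * Koszul cohomology of logarithmic derivations *)
Section LogarithmicExactness.
Variables (K : fieldType) (V : vectType K) (A : arrangement V) (m : A -> nat).
Local Notation n := (\dim {:V}).
Local Notation S := {mpoly K[n]}.
Local Notation form := 'Hom(V, K^o).
Local Notation e := (vbasis {:V}).
Local Notation sym := (@sym_form K V : form -> S).
Implicit Types (B : {set A}).

Definition coef_vec (theta : S -> S) : poly_vecs V := [ffun i => theta 'X_i].

Definition derivation_of (t : poly_vecs V) (p : S) : S := \sum_i (t i : S) * p^`M(i).

Lemma derivation_derivation_of t : derivation (derivation_of t).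
Proof.
split=> [a p q|p q]; rewrite /derivation_of.
  rewrite scaler_sumr -big_split; apply: eq_bigr => i _ /=.
  by rewrite mderivD mderivZ mulrDr -scalerAr.
rewrite mulr_suml mulr_sumr -big_split; apply: eq_bigr => i _ /=.
by rewrite mderivM mulrDr; congr (_ + _); [rewrite mulrA | rewrite mulrCA].
Qed.

Lemma coef_vec_derivation_of t : coef_vec (derivation_of t) = t.
Proof.
apply/ffunP => i; rewrite ffunE /derivation_of (bigD1 i) //= big1 => [|j ij].
  rewrite mderivX mnm1E eqxx scale1r -[X in (X - _)%MM]add0m addmK.
  by rewrite mpolyX0 mulr1 addr0.
by rewrite mderivX mnm1E eq_sym (negPf ij) scale0r mulr0.
Qed.

Section Derivation.
Variable theta : S -> S.
Hypothesis der : derivation theta.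

Lemma der0 : theta 0 = 0.
Proof. by have := der.1 (-1) 0 0; rewrite scaler0 addr0 scaleN1r addNr. Qed.

Lemma der_scale a p : theta (a *: p) = a *: theta p.
Proof. by rewrite -[a *: p]addr0 der.1 der0 addr0. Qed.

Lemma der_add p q : theta (p + q) = theta p + theta q.
Proof. by rewrite -[p]scale1r der.1 !scale1r. Qed.

Lemma der1 : theta 1 = 0.
Proof.
have := der.2 1 1; rewrite !mulr1 mul1r => /eqP.
by rewrite -subr_eq subrr eq_sym => /eqP.
Qed.

Lemma derivation_of_coef_vec : theta =1 derivation_of (coef_vec theta).
Proof.
have dD := derivation_derivation_of (coef_vec theta); set D := derivation_of _ in dD *.
have D0 : D 0 = 0.
  by rewrite /D /derivation_of big1 // => i _; rewrite mderiv0 mulr0.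
have D1 : D 1 = 0.
  by rewrite /D /derivation_of big1 // => i _; rewrite -mpolyC1 mderivC mulr0.
have DX i : D 'X_i = theta 'X_i.
  by have /ffunP/(_ i) := coef_vec_derivation_of (coef_vec theta); rewrite !ffunE.
elim/mpolyind => [|a u p _ _ IH]; first by rewrite D0 der0.
rewrite der.1 dD.1 IH; congr (_ *: _ + _).
rewrite mpolyXE_id; apply: (big_ind (fun p => theta p = D p)).
- by rewrite D1 der1.
- by move=> p1 p2 e1 e2; rewrite der.2 dD.2 e1 e2.
- move=> i _; elim: (u i) => [|k IHk]; first by rewrite expr0 D1 der1.
  by rewrite exprS der.2 dD.2 IHk DX.
Qed.

Lemma der_form f : theta (sym f) = apply_form f (coef_vec theta).
Proof.
rewrite /sym_form /apply_form (big_morph theta der_add der0); apply: eq_bigr => i _.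
by rewrite der_scale ffunE.
Qed.

End Derivation.

Lemma logder_coef_vec theta : logder m theta -> logvec m [set: A] (coef_vec theta).
Proof.
by case=> der log H _; have [q Eq] := log H; exists q; rewrite -der_form.
Qed.

Lemma logder_derivation_of t : logvec m [set: A] t -> logder m (derivation_of t).
Proof.
move=> Dt; have der := derivation_derivation_of t; split=> // H.
have [q Eq] := Dt H (in_setT H); exists q.
by rewrite der_form // coef_vec_derivation_of.
Qed.

Lemma exact_free_arrangement (fs : seq form) i :
  free_multiarrangement m -> free fs -> (i < size fs)%N ->
  koszul_exact (map sym fs) i (logvec m [set: A]) (@zeromod S (poly_vecs V)).
Proof.
case=> I [b [Mb span_b free_b]] fs_free ilt.
apply: (@exact_free _ _ I (fun j => coef_vec (b j))).
- exact: submodule_logvec.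
- by move=> j; apply: logder_coef_vec.
- move=> u /logder_derivation_of/span_b [s [c Ec]]; exists s, c.
  rewrite -[LHS]coef_vec_derivation_of; apply/ffunP => i0; rewrite ffunE Ec sum_ffunE.
  by apply: eq_bigr => j _; rewrite !ffunE.
- move=> r a r_uniq a0; apply: (free_b r a r_uniq) => p.
  have Eb j : b j p = derivation_of (coef_vec (b j)) p.
    by rewrite -derivation_of_coef_vec //; case: (Mb j).
  rewrite (eq_bigr (fun j => \sum_i (a j * coef_vec (b j) i) * p^`M(i))); last first.
    move=> j _; rewrite Eb /derivation_of mulr_sumr.
    by apply: eq_bigr => i0 _; rewrite mulrA.
  rewrite exchange_big big1 // => i0 _; rewrite -mulr_suml.
  have /ffunP/(_ i0) := a0; rewrite sum_ffunE ffunE => E.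
  rewrite (eq_bigr (fun j => (a j *: coef_vec (b j)) i0)) ?E ?mul0r // => j _.
  by rewrite !ffunE.
- exact: exact_poly.
Qed.

(** The subarrangements that are localizations of the whole arrangement. *)
Definition closed_subarr B := forall H, (arr_center B <= lker (alpha H))%VS -> H \in B.

Lemma closed_separated B H : closed_subarr B -> H \notin B ->
  exists2 y, y \in arr_center B & alpha H y = 1.
Proof.
move=> clB BH; have /subvPn [y By] : ~~ (arr_center B <= lker (alpha H))%VS.
  by apply: contra BH; apply: clB.
rewrite memv_ker => aHy; exists ((alpha H y)^-1 *: y); first exact: rpredZ.
by rewrite linearZ /= /GRing.scale /= mulVf.
Qed.

(** Multiplication by it carries derivations that are logarithmic along B to
    derivations that are logarithmic along B and [D]. *)
Definition away_product (D : {set A}) : S := \prod_(H in D) sym (alpha H) ^+ m H.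

Lemma away_logvec (D B C : {set A}) t : C \subset B :|: D ->
  logvec m B t -> logvec m C (away_product D *: t).
Proof.
move=> /subsetP sCBD Dt H /sCBD.
have E : apply_form (alpha H) (away_product D *: t) =
    away_product D * apply_form (alpha H) t.
  have := apply_formP (alpha H) (away_product D) t 0; rewrite addr0 => ->.
  by rewrite [apply_form _ 0]big1 ?addr0 // => i _; rewrite ffunE scaler0.
rewrite E inE; case/orP => [/Dt [h ->]|DH].
  by exists (away_product D * h); rewrite mulrA.
rewrite /away_product (bigD1 H) //=; set g := \prod_(_ in _ | _) _.
by exists (g * apply_form (alpha H) t); rewrite [RHS]mulrC mulrA.
Qed.

(** Modulo coboundaries with values in D(B) the forms alpha_H, H outside B, are
    nonzerodivisors, because they can be divided out along a vector of the center
    of B, at which the [vs] vanish.  On the other hand their product moves a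
    cocycle into D(A), where it is a coboundary. *)
Lemma exact_central B (vs : seq form) i :
  free_multiarrangement m -> closed_subarr B -> free vs ->
  {in vs, forall f : form, {in arr_center B, forall v, f v = 0}} -> (i < size vs)%N ->
  koszul_exact (map sym vs) i (logvec m B) (@zeromod S (poly_vecs V)).
Proof.
move=> free_m clB vs_free vs0 ilt c Dc c0.
(* [P g]: g is a nonzerodivisor modulo coboundaries with values in D(B). *)
pose P (g : S) := forall z b : bitseq -> poly_vecs V, (forall s, logvec m B (b s)) ->
  (forall s, has_degree (size vs) i s -> g *: z s = koszul_d (map sym vs) b s) ->
  exists2 b' : bitseq -> poly_vecs V, (forall s, logvec m B (b' s)) &
  forall s, has_degree (size vs) i s -> z s = koszul_d (map sym vs) b' s.
have P1 : P 1.
  by move=> z b Db Eb; exists b => // s ds; rewrite -Eb // scale1r.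
have PM g h : P g -> P h -> P (g * h).
  move=> Pg Ph z b Db Eb; have [s ds|b' Db' Eb'] := Pg (fun s => h *: z s) b Db.
    by rewrite scalerA Eb.
  exact: Ph Db' Eb'.
have Pa : P (away_product (~: B)).
  rewrite /away_product; apply: (big_ind P P1 PM) => H; rewrite inE => BH.
  elim: (m H) => [|k IH]; first by rewrite expr0; exact: P1.
  rewrite exprS; apply: PM IH => z b Db Eb.
  have [y By aHy] := closed_separated clB BH.
  have [q qop] := quotient_logvec m aHy By (fun f fs_f => vs0 f fs_f y By).
  exists (q \o b) => [s|s ds]; first by case: qop => _ _ _; apply.
  by apply: (quotient_koszul_d (b := b) (i := i) qop); rewrite size_map.
have [||b Db Eb] := exact_free_arrangement free_m vs_free ilt
  (c := fun s => away_product (~: B) *: c s).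
- by move=> s; apply: away_logvec (Dc s); rewrite setUCr.
- by move=> s ds; rewrite /zeromod koszul_dZ c0 // scaler0.
rewrite size_map in Eb.
have [||b' Db' Eb'] := Pa c b.
- by move=> s H BH; apply: Db; rewrite inE.
- by move=> s ds; apply/eqP; rewrite -subr_eq0; apply/eqP/Eb.
by exists b' => // s; rewrite size_map => ds; rewrite /zeromod Eb' ?subrr.
Qed.

Lemma span_dot (l : seq form) f : f \in <<l>>%VS ->
  exists2 ks : seq S, size ks = size l & sym f = dot_seq ks (map sym l).
Proof.
elim: l f => [|g l IH] f.
  by rewrite span_nil memv0 => /eqP ->; exists [::]; rewrite ?linear0.
rewrite span_cons => /memv_addP[_ /vlineP[a ->]] [f' /IH[ks sk Ek] ->].
exists (a%:MP :: ks); rewrite /= ?sk // linearD linearZ /= Ek.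
by rewrite mul_mpolyC.
Qed.

(** Induction on [fs], with [vs] collecting forms that vanish on the center.  If
    the head f is independent, on the center, of the rest of [fs], one divides by
    f along a vector of the center.  Otherwise subtracting a combination of [fs]
    makes f vanish on the center, and it is moved to [vs]. *)
Lemma exact_local B (fs vs : seq form) i :
  free_multiarrangement m -> closed_subarr B -> free (fs ++ vs) ->
  {in vs, forall f : form, {in arr_center B, forall v, f v = 0}} ->
  (i < size (fs ++ vs))%N ->
  koszul_exact (map sym (fs ++ vs)) i (logvec m B) (@zeromod S (poly_vecs V)).
Proof.
move=> free_m clB; have sD := submodule_logvec m B.
have sz := @submodule_zeromod S (poly_vecs V).
elim: fs vs i => [|f fs IH] vs i; first exact: exact_central.
rewrite /= free_cons => /andP[lf l_free] vs0 ilt.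
pose Z : {vspace form} := lker (linfun (@res_center K V A B)).
have memZ (g : form) : reflect {in arr_center B, forall v, g v = 0} (g \in Z).
  exact: mem_Rsub0.
case: (boolP (f \in (<<fs>> + Z)%VS)) => [|fZ].
  case/memv_addP => phi phi_fs [v Zv Ef].
  have phi_l : phi \in <<fs ++ vs>>%VS by rewrite span_cat -[phi]addr0 memv_add ?mem0v.
  have [ks sk Ek] := span_dot phi_l.
  have -> : sym f = sym v + dot_seq ks (map sym (fs ++ vs)).
    by rewrite Ef linearD /= Ek addrC.
  apply: koszul_equiv_exact; [exact: sD | exact: sz | | ].
    by apply: koszul_equiv_head; rewrite size_map.
  rewrite map_cat; apply: exact_move_head => //; rewrite -map_cons -map_cat.
  apply: IH => //; last by rewrite size_cat /= addnS -size_cat.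
    have /perm_free -> : perm_eq (fs ++ v :: vs) (v :: fs ++ vs).
      by rewrite perm_catC /= perm_cons perm_catC.
    rewrite free_cons l_free andbT; apply: contra lf => lv.
    by rewrite Ef rpredD.
  by move=> g; rewrite inE => /orP[/eqP -> | /vs0 //]; apply/memZ.
have [y [fy y0]] := separate_forms fZ.
have By : y \in arr_center B.
  apply/mem_arr_center => H BH; apply: y0; rewrite -[alpha H]add0r memv_add ?mem0v //.
  by apply/memZ => v /mem_arr_center; apply.
have [|q qop] := quotient_logvec (fs := fs ++ vs) m fy By.
  move=> g; rewrite mem_cat => /orP[fs_g | /vs0]; last by apply.
  by apply: y0; rewrite -[g]addr0 memv_add ?mem0v ?memv_span.
apply: (exact_cons sD qop) => i0; apply: IH => //.
by case: i i0 ilt.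
Qed.

Lemma exact_logvec B (fs : seq form) i :
  free_multiarrangement m -> closed_subarr B -> free fs -> (i.+1 < size fs)%N ->
  koszul_exact (map sym fs) i (@fullmod S (poly_vecs V)) (logvec m B).
Proof.
move=> free_m clB fs_free ilt.
have ex B' j : closed_subarr B' -> (j < size fs)%N ->
    koszul_exact (map sym fs) j (logvec m B') (@zeromod S (poly_vecs V)).
  by move=> clB' jlt; rewrite -[fs]cats0; apply: exact_local; rewrite ?cats0.
apply: exact_quotient; [exact: submodule_logvec | exact: ex |].
have cl0 : closed_subarr set0.
  move=> H; rewrite /arr_center big_set0 => sVH; case/negP: (alpha_neq0 H).
  apply/eqP/lfunP => v; rewrite zero_lfunE; apply/eqP.
  by rewrite -memv_ker (subvP sVH) ?memvf.
move=> c _ c0; have [s H|//|b _ Eb] := ex _ _ cl0 (ltnW ilt) c; first by rewrite inE.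
by exists b.
Qed.
End LogarithmicExactness.

(** * Flats and localizations *)
Section Flats.
Variables (K : fieldType) (V : vectType K) (A : arrangement V).
Local Notation form := 'Hom(V, K^o).
Implicit Types (B C T : {set A}) (X Y Z : {vspace V}).

Lemma flatsP B X :
  reflect (exists2 C : {set A}, C \subset B & X = arr_center C) (X \in flats B).
Proof.
rewrite mem_undup; apply: (iffP mapP) => [[C]|[C sCB ->]].
  by rewrite mem_enum powersetE => sCB ->; exists C.
by exists C; rewrite // mem_enum powersetE.
Qed.

Lemma arr_centerS C B : C \subset B -> (arr_center B <= arr_center C)%VS.
Proof.
move=> /subsetP sCB; apply/subvP => v /mem_arr_center Bv.
by apply/mem_arr_center => H /sCB; apply: Bv.
Qed.

Lemma arr_center_sub B H : H \in B -> (arr_center B <= lker (alpha H))%VS.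
Proof. by move=> BH; rewrite /arr_center; apply: bigcapv_inf (subvv _). Qed.

Lemma localizationS B X : localization B X \subset B.
Proof. by apply/subsetP => H; rewrite inE => /andP[]. Qed.

Lemma flatsS C B : C \subset B -> {subset flats C <= flats B}.
Proof.
move=> sCB X /flatsP[T sTC ->]; apply/flatsP; exists T => //.
exact: subset_trans sTC sCB.
Qed.

Lemma sub_arr_center_loc B X : (X <= arr_center (localization B X))%VS.
Proof. by apply/subv_bigcapP => H; rewrite inE => /andP[]. Qed.

Lemma flats_loc_sub B Y Z : Z \in flats (localization B Y) -> (Y <= Z)%VS.
Proof.
case/flatsP => C sC ->; apply: subv_trans (arr_centerS sC).
exact: sub_arr_center_loc.
Qed.

Lemma arr_center_loc B X : X \in flats B -> arr_center (localization B X) = X.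
Proof.
case/flatsP => C sCB defX; apply/eqP; rewrite eqEsubv sub_arr_center_loc andbT.
rewrite {2}defX; apply/arr_centerS/subsetP => H CH.
by rewrite inE (subsetP sCB) // defX arr_center_sub.
Qed.

Lemma loc_loc B Y Z : (Y <= Z)%VS ->
  localization (localization B Y) Z = localization B Z.
Proof.
move=> sYZ; apply/setP => H; rewrite !inE -andbA; congr (_ && _).
by case: (boolP (Z <= _)%VS) => [/(subv_trans sYZ) ->|]; rewrite ?andbF.
Qed.

Lemma closed_subarr_loc B Y : closed_subarr B -> closed_subarr (localization B Y).
Proof.
move=> clB H sH; rewrite inE (subv_trans (sub_arr_center_loc B Y)) // andbT.
apply: clB; apply: subv_trans sH; exact/arr_centerS/localizationS.
Qed.

Lemma closed_subarr_setT : closed_subarr [set: A].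
Proof. by move=> H _; rewrite inE. Qed.

Lemma codimvS X Y : (X <= Y)%VS -> (codimv Y <= codimv X)%N.
Proof. by move=> sXY; rewrite leq_sub2l // dimvS. Qed.

Lemma codimv_eq X Y : (X <= Y)%VS -> (codimv X <= codimv Y)%N -> X = Y.
Proof.
move=> sXY le_cd; apply/eqP; rewrite eqEdim sXY.
by move: le_cd (dimvS (subvf X)) (dimvS (subvf Y)) (dimvS sXY); rewrite /codimv; lia.
Qed.

Lemma codimv_lker X (f : form) : (codimv (X :&: lker f)%VS <= (codimv X).+1)%N.
Proof.
have dX := limg_ker_dim f X.
have d1 : (\dim (f @: X) <= 1)%N by rewrite (leq_trans (dimvS (subvf _))) ?dimvf.
rewrite /codimv; move: dX d1 (dimvS (subvf X)); lia.
Qed.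

(** Between two centers every rank is realized. *)
Lemma center_of_rank T B j : T \subset B ->
  (codimv (arr_center T) <= j <= codimv (arr_center B))%N ->
  exists2 T' : {set A}, T \subset T' /\ T' \subset B & codimv (arr_center T') = j.
Proof.
move=> sTB /andP[leTj lejB].
pose p T' := [&& T \subset T', T' \subset B & (codimv (arr_center T') <= j)%N].
have [|T' /maxsetP[/and3P[sTT' sT'B leT'j] maxT'] _] := @maxset_exists _ p T.
  by rewrite /p subxx sTB.
exists T' => //; apply/eqP; rewrite eqn_leq leT'j leqNgt; apply/negP => lt_j.
have /existsP[H /andP[BH nH]] :
    [exists H : A, (H \in B) && ~~ (arr_center T' <= lker (alpha H))%VS].
  apply: contraLR lejB; rewrite negb_exists => /forallP sT'.
  rewrite -ltnNge (leq_ltn_trans _ lt_j) //; apply: codimvS.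
  apply/subv_bigcapP => H BH; have := sT' H; by rewrite BH negbK.
case/negP: nH; apply: arr_center_sub; rewrite -(maxT' (H |: T')) ?setU11 ?subsetUr //.
rewrite /p (subset_trans sTT') ?subsetUr //= subUset sub1set BH sT'B /=.
apply: leq_trans lt_j; apply: leq_trans (codimv_lker _ (alpha H)).
apply: codimvS; apply/subvP => v; rewrite memv_cap => /andP[/mem_arr_center T'v].
rewrite memv_ker => /eqP Hv; apply/mem_arr_center => H'.
by rewrite !inE => /orP[/eqP ->|] //; apply: T'v.
Qed.

Lemma mem_bigcap_lker (l : seq form) v : v \in (\bigcap_(f <- l) lker f)%VS ->
  forall f, f \in l -> f v = 0.
Proof.
elim: l => // g l IH; rewrite big_cons memv_cap memv_ker => /andP[/eqP gv /IH lv] f.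
by rewrite inE => /orP[/eqP ->|/lv].
Qed.

(** A basis of the span of the forms, extracted from them. *)
Lemma independent_forms T : exists fs : seq form,
  [/\ free fs, {subset fs <= [seq alpha H | H in T]} &
      (codimv (arr_center T) <= size fs)%N].
Proof.
suff IH (l : seq form) : exists fs : seq form,
    [/\ free fs, {subset fs <= l}, <<fs>>%VS = <<l>>%VS &
      (codimv (\bigcap_(f <- l) lker f)%VS <= size fs)%N].
  have [fs [fs_free sub _]] := IH [seq alpha H | H in T].
  by rewrite big_map big_enum; exists fs.
elim: l => [|f l [fs [fs_free sub eq_span le_cd]]].
  by exists [::]; rewrite nil_free big_nil /codimv subnn.
have sub' g : g \in fs -> g \in f :: l by move/sub => lg; rewrite inE lg orbT.
rewrite big_cons; case: (boolP (f \in <<fs>>%VS)) => [fs_f|fs'f].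
  exists fs; split=> //.
    by rewrite span_cons -eq_span; apply/esym/addv_idPr; rewrite -memvE.
  apply: leq_trans le_cd; apply: codimvS; rewrite subv_cap subvv andbT.
  apply/subvP => v lv; rewrite memv_ker.
  move: fs_f; rewrite eq_span => fs_f.
  rewrite (coord_span (X := in_tuple l) fs_f) sum_lfunE big1 // => i _.
  rewrite scale_lfunE; have : (in_tuple l)`_i \in l by rewrite mem_nth.
  by move/(mem_bigcap_lker lv) => ->; rewrite scaler0.
exists (f :: fs); split=> //.
- by rewrite free_cons fs'f.
- by move=> g; rewrite inE => /orP[/eqP ->|/sub' //]; rewrite mem_head.
- by rewrite !span_cons eq_span.
by rewrite capvC; apply: leq_trans (codimv_lker _ _) _.
Qed.

End Flats.

(** * Iterated cokernels *)
Section Nested.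
Variables (K : fieldType) (V : vectType K) (A : arrangement V).
Implicit Types (B C : {set A}).

Section Relations.
Variables (R : comNzRingType) (T : lmodType R) (N0 : {set A} -> T -> Prop).

(** The module D^(k+1)(B) is [nested k] modulo [nested_rel k B].  The coordinates
    at flats that do not belong to the sum are left free, that is, they are
    killed in the quotient, so one ambient module serves all B. *)
Fixpoint nested k : lmodType R :=
  if k is k'.+1 then {ffun flat A -> nested k'} else T.

Definition at_flat k (y : nested k.+1) (Y : flat A) : nested k :=
  (y : {ffun flat A -> nested k}) Y.

Fixpoint nested_rel k : {set A} -> nested k -> Prop :=
  match k with
  | 0 => N0
  | k'.+1 => fun B y => exists u, forall Y : flat A, flat_of_rank k'.+1 B Y ->
      nested_rel (localization B (val Y)) (at_flat y Y - u)
  end.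

Lemma at_flatP k a (x y : nested k.+1) Y :
  at_flat (a *: x + y) Y = a *: at_flat x Y + at_flat y Y.
Proof. by rewrite /at_flat !ffunE. Qed.

Lemma at_flat0 k Y : at_flat (0 : nested k.+1) Y = 0.
Proof. by rewrite /at_flat ffunE. Qed.

Lemma at_flatB k (x y : nested k.+1) Y : at_flat (x - y) Y = at_flat x Y - at_flat y Y.
Proof. by rewrite /at_flat !ffunE. Qed.

Lemma at_flatZ k a (x : nested k.+1) Y : at_flat (a *: x) Y = a *: at_flat x Y.
Proof. by rewrite /at_flat !ffunE. Qed.

Hypothesis N0_sub : forall B, submodule (N0 B).

Lemma submodule_nested_rel k B : submodule (@nested_rel k B).
Proof.
elim: k B => [|k IH] B //=; split=> [|a x y [u xu] [v yv]].
  by exists 0 => Y _; rewrite at_flat0 subr0; apply: submod0.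
exists (a *: u + v) => Y BY; rewrite at_flatP.
have -> : a *: at_flat x Y + at_flat y Y - (a *: u + v) =
    a *: (at_flat x Y - u) + (at_flat y Y - v).
  by rewrite scalerBr opprD addrACA.
by case: (IH (localization B (val Y))) => _; apply; [apply: xu|apply: yv].
Qed.

Lemma flat_of_rank_loc k B Y (Z : flat A) :
  flat_of_rank k (localization B Y) Z ->
  flat_of_rank k B Z /\
  localization (localization B Y) (val Z) = localization B (val Z).
Proof.
case/andP=> FZ rZ; split; last exact/loc_loc/(flats_loc_sub FZ).
by rewrite /flat_of_rank rZ (flatsS (localizationS B Y)).
Qed.

Hypothesis N0S : forall B C t, C \subset B -> N0 B t -> N0 C t.

Lemma nested_rel_loc k B Y u : @nested_rel k B u -> @nested_rel k (localization B Y) u.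
Proof.
case: k u => [|k] u /=; first by apply: N0S; apply: localizationS.
case=> v uv; exists v => Z /flat_of_rank_loc [/uv]; by move=> uZ ->.
Qed.

Hypothesis N0_0 : forall t, N0 set0 t.

(** D^(k+1)(B) is zero when B has rank at most k: the cokernel of the identity in
    rank k, and an empty sum below. *)
Lemma nested_rel_full k B u : (codimv (arr_center B) <= k)%N -> @nested_rel k B u.
Proof.
case: k u => [|k] u le_k /=.
  have -> : B = set0; last exact: N0_0.
  apply/setP => H; rewrite inE; apply/negP => BH.
  have cV : arr_center B = fullv.
    by apply: codimv_eq; rewrite ?subvf // (leq_trans le_k).
  case/negP: (alpha_neq0 H); apply/eqP/lfunP => v; rewrite zero_lfunE.
  have /mem_arr_center : v \in arr_center B by rewrite cV memvf.
  by apply.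
have uniqY Y Z : flat_of_rank k.+1 B Y -> flat_of_rank k.+1 B Z -> Y = Z.
  have E (X : flat A) : flat_of_rank k.+1 B X -> val X = arr_center B.
    case/andP=> /flatsP[C sCB EX] /eqP rX; apply/esym/codimv_eq.
      by rewrite EX arr_centerS.
    by rewrite rX.
  by move=> /E EY /E EZ; apply: val_inj; rewrite EY EZ.
case: (pickP (flat_of_rank k.+1 B)) => [Y BY|noY].
  exists (at_flat u Y) => Z BZ; rewrite (uniqY _ _ BZ BY) subrr.
  by apply: submod0; apply: submodule_nested_rel.
by exists 0 => Z; rewrite noY.
Qed.

End Relations.

Section Transfer.
Variables (R R' : comNzRingType) (T : lmodType R) (T' : lmodType R') (eta : T -> T').

Fixpoint nested_map k : nested T k -> nested T' k :=
  match k with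
  | 0 => eta
  | k'.+1 => fun y => [ffun Y => nested_map (at_flat y Y)]
  end.

Variables (N0 : {set A} -> T -> Prop) (N0' : {set A} -> T' -> Prop).
Hypothesis etaB : {morph eta : x y / x - y}.
Hypothesis etaN : forall B t, N0 B t -> N0' B (eta t).

Lemma nested_mapB k : {morph @nested_map k : x y / x - y}.
Proof.
elim: k => // k IH x y; apply/ffunP => Y.
by rewrite /= !ffunE at_flatB IH.
Qed.

Lemma nested_map_rel k B y : nested_rel N0 B y -> nested_rel N0' B (@nested_map k y).
Proof.
elim: k B y => [|k IH] B y; first exact: etaN.
by case=> u yu; exists (nested_map u) => Y /yu/IH; rewrite nested_mapB /at_flat ffunE.
Qed.
End Transfer.

Lemma nested_mapK (R R' : comNzRingType) (T : lmodType R) (T' : lmodType R')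
  (f : T -> T') (g : T' -> T) k :
  cancel f g -> cancel (@nested_map _ _ _ _ f k) (nested_map g (k := k)).
Proof.
move=> fK; elim: k => // k IH y; apply/ffunP => Y.
by rewrite /= ffunE /at_flat ffunE IH.
Qed.

End Nested.

(** * Depth of the iterated cokernels *)
Section KoszulShift.
Variables (K : fieldType) (V : vectType K) (A : arrangement V) (m : A -> nat).
Local Notation n := (\dim {:V}).
Local Notation S := {mpoly K[n]}.
Local Notation form := 'Hom(V, K^o).
Local Notation sym := (@sym_form K V : form -> S).
Local Notation nested_vecs := (nested A (poly_vecs V)).
Implicit Types (B C T : {set A}).

Definition log_rel k B : nested_vecs k -> Prop :=
  nested_rel (@logvec K V A m) B (k := k).

Lemma submodule_log_rel k B : submodule (@log_rel k B).
Proof. exact/submodule_nested_rel/submodule_logvec. Qed.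

Lemma logvecS B C t : C \subset B -> logvec m B t -> logvec m C t.
Proof. by move=> /subsetP sCB Dt H /sCB; apply: Dt. Qed.

Lemma logvec0 t : logvec m set0 t.
Proof. by move=> H; rewrite inE. Qed.

Definition log_rel_loc := nested_rel_loc logvecS.
Definition log_rel_full := nested_rel_full (submodule_logvec m) logvec0.

(** Inverting the forms alpha_H for H in B outside B_Y identifies D^(k+1)(B) with
    D^(k+1)(B_Y).  One factor of the product is enough at every level: in the
    recursive step the flats of B_Y are treated by the induction hypothesis on
    witnesses, and any other flat Z contributes a module that the product kills,
    since B_Z localized at Y has smaller rank than B_Z. *)
Lemma log_rel_away k B Y u : log_rel (localization B Y) u ->
  log_rel B (away_product m (B :\: localization B Y) *: u : nested_vecs k).
Proof.
elim: k B u => [|k IH] B u.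
  by apply: away_logvec; apply/subsetP => H BH; rewrite in_setU in_setD BH andbT orbN.
case=> v uv; exists (away_product m (B :\: localization B Y) *: v) => Z BZ.
rewrite at_flatZ -scalerBr; case: (boolP (val Z \in flats (localization B Y))) => FZ.
  have lZ : flat_of_rank k.+1 (localization B Y) Z.
    by rewrite /flat_of_rank FZ; case/andP: BZ.
  have [_ <-] := flat_of_rank_loc lZ.
  by apply: submodZ; [exact: submodule_log_rel | exact: uv].
(* Z is a flat of B but not of B_Y, so B_Z localized at Y has rank at most k. *)
set C := localization B (val Z); pose D := C :\: localization C Y.
have sD : D \subset B :\: localization B Y.
  apply/subsetP => H; rewrite /D /C !inE; case: (H \in B) => //=.
  by case: (val Z <= _)%VS.
have -> : away_product m (B :\: localization B Y) =
    away_product m ((B :\: localization B Y) :\: D) * away_product m D.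
  rewrite /away_product [LHS](big_setID D) /= mulrC; congr (_ * _).
  by apply: eq_bigl => H; rewrite (setIidPr sD).
rewrite -scalerA; apply: submodZ; first exact: submodule_log_rel.
apply: IH; apply: log_rel_full.
have /andP[BZ1 /eqP rZ] := BZ; rewrite -ltnS -rZ ltnNge; apply: contra FZ => le_cd.
have sZ : (val Z <= arr_center (localization C Y))%VS.
  rewrite -{1}(arr_center_loc BZ1); apply: arr_centerS; exact: localizationS.
rewrite (codimv_eq sZ le_cd); apply/flatsP; exists (localization C Y) => //.
by apply/subsetP => H; rewrite !inE => /andP[/andP[-> _] ->].
Qed.

Lemma koszul_d_const k (N : nested_vecs k -> Prop) (gs : seq S) z s : submodule N ->
  (forall g, g \in gs -> N (g *: z)) -> has_degree (size gs) 1 s ->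
  N (koszul_d gs (fun=> z) s).
Proof.
move=> sN; elim: gs s => [|g gs IH] [|[] s] Nz //=; rewrite has_degree_cons /= => ds.
  by rewrite (koszul_d_deg0 _ ds) subr0; apply: Nz; rewrite mem_head.
by apply: IH => // h gs_h; apply: Nz; rewrite inE gs_h orbT.
Qed.

(** If a product of forms kills a nonzero z modulo N, a nonzero multiple of z is
    killed by one of the forms. *)
Lemma away_torsion k (N : nested_vecs k -> Prop) (D : {set A}) z : submodule N ->
  ~ N z -> N (away_product m D *: z) ->
  exists h, exists2 H, H \in D & ~ N (h *: z) /\ N (sym (alpha H) *: (h *: z)).
Proof.
move=> sN; pose P (g : S) := forall z, ~ N z -> N (g *: z) ->
  exists h, exists2 H, H \in D & ~ N (h *: z) /\ N (sym (alpha H) *: (h *: z)).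
have P1 : P 1 by move=> {}z nz; rewrite scale1r.
have PM g h : P g -> P h -> P (g * h).
  move=> Pg Ph {}z nz; rewrite -scalerA => Nz.
  case: (classic (N (h *: z))) => [|nhz]; first exact: Ph.
  have [h' [H DH []]] := Pg _ nhz Nz; rewrite !scalerA => n1 n2.
  by exists (h' * h), H => //; split=> //; rewrite scalerA.
suff Pa : P (away_product m D) by apply: Pa.
rewrite /away_product; apply: (big_ind P P1 PM) => H DH.
elim: (m H) => [|j IH]; first by rewrite expr0; exact: P1.
rewrite exprS; apply: PM IH => {}z nz Nz; exists 1, H => //.
by rewrite scale1r.
Qed.

(** The torsion argument. *)
(** For u outside the relations choose a multiple of u, nonzero in the quotient,
    killed by alpha_H for a maximal set T of hyperplanes H.  If T has rank at
    least k+2 this contradicts exactness in degree 0.  Otherwise T is contained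
    in B_Y for a flat Y of rank k+1, where u is a relation, so the product of the
    forms outside B_Y kills u and yields a larger T. *)
Lemma log_rel_descent k B (u : nested_vecs k) :
  (forall fs : seq form, free fs -> (k.+1 < size fs)%N ->
     koszul_exact (map sym fs) 0 (@fullmod S (nested_vecs k)) (@log_rel k B)) ->
  (forall Y : flat A, flat_of_rank k.+1 B Y -> log_rel (localization B (val Y)) u) ->
  log_rel B u.
Proof.
move=> ex locu; have sN := @submodule_log_rel k B.
case: (leqP (codimv (arr_center B)) k) => [|lt_k]; first exact: log_rel_full.
apply: NNPP => nu.
pose Q T := T \subset B /\ exists h : S, ~ log_rel B (h *: u) /\
  forall H, H \in T -> log_rel B (sym (alpha H) *: (h *: u)).
pose p T : bool := if excluded_middle_informative (Q T) then true else false.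
have pP T : reflect (Q T) (p T).
  by rewrite /p; case: excluded_middle_informative => q; constructor.
have [|T /maxsetP[/pP[sTB [h [nhu hu]]] maxT] _] := @maxset_exists _ p set0.
  apply/pP; split; first exact: sub0set.
  by exists 1; rewrite scale1r; split=> // H; rewrite inE.
case: (ltnP k.+1 (codimv (arr_center T))) => [lt_cd|le_cd].
  have [fs [fs_free fsT le_fs]] := independent_forms T.
  have [//|s ds|b _ Eb] := ex fs fs_free (leq_trans lt_cd le_fs) (fun=> h *: u).
    apply: koszul_d_const ds => // g /mapP[f /fsT /imageP[H TH ->] ->]; exact: hu.
  apply: nhu; have := Eb (nseq (size (map sym fs)) false).
  have d0 : has_degree (size (map sym fs)) 0 (nseq (size (map sym fs)) false).
    by rewrite /has_degree size_nseq count_nseq mul0n !eqxx.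
  by rewrite koszul_d_deg0 // subr0; apply.
have [|T' [sTT' sT'B] cdT'] := center_of_rank (j := k.+1) sTB; first by rewrite le_cd.
have FT' : arr_center T' \in flats [set: A].
  by apply/flatsP; exists T'; rewrite ?subsetT.
pose Y : flat A := SeqSub FT'.
have BY : flat_of_rank k.+1 B Y.
  by rewrite /flat_of_rank /= cdT' eqxx andbT; apply/flatsP; exists T'.
have := log_rel_away (locu _ BY); set D := B :\: _ => Nau.
have [|h' [H DH [n1 n2]]] := away_torsion (D := D) sN nhu.
  by rewrite scalerA mulrC -scalerA; apply: submodZ.
have TH : H \in T.
  rewrite -(maxT (H |: T)) ?setU11 ?subsetUr //; apply/pP; split.
    by rewrite subUset sub1set sTB andbT; move: DH; rewrite inE => /andP[].
  exists (h' * h); rewrite -scalerA; split=> // H'.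
  rewrite !inE => /orP[/eqP -> //|/hu NH'].
  by rewrite scalerA mulrC -scalerA; apply: submodZ.
move: DH; rewrite !inE /= => /andP[]; rewrite negb_and => /orP[/negP //|nY BH].
by case/negP: nY; apply: arr_center_sub; apply: (subsetP sTT').
Qed.

(** Dimension shifting along
      0 -> D^(k+1)(B) -> sum of the D^(k+1)(B_Y) -> D^(k+2)(B) -> 0,
    whose exactness on the left is the first hypothesis: the witnesses [u] of the
    relations d c form a cochain of degree i+1, which is a cocycle by that
    hypothesis. *)
Lemma exact_shift k B (gs : seq S) i :
  (forall u : nested_vecs k, (forall Y : flat A, flat_of_rank k.+1 B Y ->
     log_rel (localization B (val Y)) u) -> log_rel B u) ->
  koszul_exact gs i.+1 (@fullmod S (nested_vecs k)) (@log_rel k B) ->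
  (forall Y : flat A, flat_of_rank k.+1 B Y ->
     koszul_exact gs i (@fullmod S (nested_vecs k))
       (@log_rel k (localization B (val Y)))) ->
  koszul_exact gs i (@fullmod S (nested_vecs k.+1)) (@log_rel k.+1 B).
Proof.
move=> loc ex exY c _ Nc.
have at_kd (d : bitseq -> nested_vecs k.+1) s (Y : flat A) :
    at_flat (koszul_d gs d s) Y = koszul_d gs (fun t => at_flat (d t) Y) s.
  elim: gs d s {ex exY Nc} => [|g gs IH] d [|[] s] /=; rewrite ?at_flat0 //.
  by rewrite at_flatB at_flatZ IH.
have /skolem [u Hu] : forall s, exists u : nested_vecs k, has_degree (size gs) i.+1 s ->
    forall Y : flat A, flat_of_rank k.+1 B Y ->
    log_rel (localization B (val Y)) (at_flat (koszul_d gs c s) Y - u).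
  move=> s; case: (boolP (has_degree (size gs) i.+1 s)) => [|_]; last by exists 0.
  case/Nc=> u Hu.
  by exists u.
have [//|s ds|w _ Hw] := ex u.
  apply: loc => Y BY; set N := log_rel _.
  have sN : submodule N by apply: submodule_log_rel.
  have := koszul_d_local (c := fun t => at_flat (koszul_d gs c t) Y - u t) sN
    (fun t dt => Hu t dt Y BY) ds.
  rewrite koszul_dB -at_kd koszul_dd at_flat0 sub0r => /(submodN sN).
  by rewrite opprK.
have /skolem [b Hb] : forall Y : flat A, exists b : bitseq -> nested_vecs k,
    flat_of_rank k.+1 B Y -> forall s, has_degree (size gs) i s ->
    log_rel (localization B (val Y)) (at_flat (c s) Y - w s - koszul_d gs b s).
  move=> Y; case: (boolP (flat_of_rank k.+1 B Y)) => [BY|_]; last by exists (fun=> 0).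
  have [//|s ds|b _ Hb] := exY Y BY (fun s => at_flat (c s) Y - w s); last by exists b.
  have sN := @submodule_log_rel k (localization B (val Y)).
  rewrite koszul_dB -at_kd -[X in X - _](subrK (u s)) -addrA.
  by apply: submodD => //; [exact: Hu | apply: log_rel_loc; apply: Hw].
exists (fun s => [ffun Y => b Y s] : nested_vecs k.+1) => // s ds.
exists (w s) => Y BY; rewrite at_flatB at_kd.
rewrite (koszul_d_ext _ _ (_ : _ =1 b Y)) => [|t]; last by rewrite /at_flat ffunE.
by rewrite addrAC; apply: Hb.
Qed.

Theorem exact_log_rel k B (fs : seq form) i :
  free_multiarrangement m -> closed_subarr B -> free fs -> (i + k.+1 < size fs)%N ->
  koszul_exact (map sym fs) i (@fullmod S (nested_vecs k)) (@log_rel k B).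
Proof.
move=> free_m; elim: k B fs i => [|k IH] B fs i clB fs_free lt_s.
  by apply: exact_logvec => //; rewrite -addn1.
apply: exact_shift => [u||Y _].
- by apply: log_rel_descent => gs gs_free lt_gs; apply: IH.
- by apply: IH => //; rewrite addSnnS.
- by apply: IH => //; [apply: closed_subarr_loc | lia].
Qed.

Corollary log_rel_locally k B (u : nested_vecs k) :
  free_multiarrangement m -> closed_subarr B ->
  (forall Y : flat A, flat_of_rank k.+1 B Y -> log_rel (localization B (val Y)) u) ->
  log_rel B u.
Proof.
by move=> free_m clB; apply: log_rel_descent => fs fs_free lt_s; apply: exact_log_rel.
Qed.

End KoszulShift.

(** * Constant relations *)
Section Constants.
Variables (K : fieldType) (V : vectType K) (A : arrangement V) (m : A -> nat).
Hypothesis m_gt0 : forall H : A, (0 < m H)%N.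
Local Notation n := (\dim {:V}).
Local Notation S := {mpoly K[n]}.
Local Notation e := (vbasis {:V}).
Implicit Types (B C : {set A}).

Definition center_rel B (v : V) : Prop := v \in arr_center B.

Definition const_rel k B : nested A V k -> Prop := nested_rel center_rel B (k := k).

Definition const_vec (v : V) : poly_vecs V := [ffun i => (coord e i v)%:MP].

Definition eval0 (t : poly_vecs V) : V := \sum_(i < n) (t i : S)@_0 *: e`_i.

Lemma const_vecK : cancel const_vec eval0.
Proof.
move=> v; rewrite [RHS](coord_vbasis (memvf v)); apply: eq_bigr => i _.
by rewrite ffunE mcoeffC eqxx mulr1.
Qed.

Lemma const_vecB : {morph const_vec : x y / x - y}.
Proof. by move=> x y; apply/ffunP => i; rewrite !ffunE linearB mpolyCB. Qed.

Lemma eval0B : {morph eval0 : x y / x - y}.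
Proof.
move=> x y; rewrite /eval0 -sumrB; apply: eq_bigr => i _.
by rewrite !ffunE mcoeffB scalerBl.
Qed.

Lemma const_vec_rel B v : center_rel B v -> logvec m B (const_vec v).
Proof.
move=> /mem_arr_center Bv H BH; exists 0; rewrite mul0r.
have -> : apply_form (alpha H) (const_vec v) = (alpha H v)%:MP.
  rewrite form_coord rmorph_sum; apply: eq_bigr => i _ /=.
  by rewrite ffunE -mul_mpolyC mulrC -mpolyCM.
by rewrite Bv ?mpolyC0.
Qed.

(** Positivity of the multiplicities enters here: a multiple of a positive power
    of a linear form vanishes at 0. *)
Lemma eval0_rel B t : logvec m B t -> center_rel B (eval0 t).
Proof.
move=> Dt; apply/mem_arr_center => H /Dt [h Eh].
have -> : alpha H (eval0 t) = (apply_form (alpha H) t)@_0.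
  rewrite /eval0 /apply_form linear_sum raddf_sum; apply: eq_bigr => i _ /=.
  by rewrite linearZ mcoeffZ mulrC.
have f0 : (sym_form (alpha H) : S)@_0 = 0.
  rewrite raddf_sum big1 // => i _ /=.
  by rewrite mcoeffZ mcoeffX mnm1_eq0 mulr0.
by rewrite Eh rmorphM rmorphXn /= f0 expr0n eqn0Ngt m_gt0 mulr0.
Qed.

Lemma const_rel_locally k B (u : nested A V k) :
  free_multiarrangement m -> closed_subarr B ->
  (forall Y : flat A, flat_of_rank k.+1 B Y -> const_rel (localization B (val Y)) u) ->
  const_rel B u.
Proof.
move=> free_m clB locu.
rewrite /const_rel -(nested_mapK (A := A) (k := k) const_vecK u).
apply: (nested_map_rel eval0B eval0_rel); apply: (log_rel_locally free_m clB) => Y BY.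
exact: (nested_map_rel const_vecB const_vec_rel (locu Y BY)).
Qed.

End Constants.

(** * Duality with the formality spaces *)
Section Duality.
Variables (K : fieldType) (V : vectType K) (A : arrangement V).
Implicit Types (B C : {set A}).

Fixpoint pairing k : Rambient A k -> nested A V k -> K :=
  match k with
  | 0 => fun (f : 'Hom(V, K^o)) v => f v
  | k'.+1 => fun (f : {ffun flat A -> Rambient A k'}) y =>
      \sum_(Y : flat A) pairing (f Y) (at_flat y Y)
  end.

Lemma pairing_linear k (y : nested A V k) :
  linear ((fun f => pairing f y) : Rambient A k -> K^o).
Proof.
elim: k y => [|k IH] y a f g /=; first by rewrite add_lfunE scale_lfunE.
rewrite scaler_sumr -big_split; apply: eq_bigr => Y _ /=.
by rewrite !ffunE; apply: (IH (at_flat y Y)).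
Qed.

Lemma pairingB k f (x y : nested A V k) : pairing f (x - y) = pairing f x - pairing f y.
Proof.
elim: k f x y => [|k IH] f x y /=; first by rewrite linearB.
by rewrite -sumrB; apply: eq_bigr => Y _; rewrite at_flatB IH.
Qed.

Definition pair_with k (y : nested A V k) (f : Rambient A k) : K^o := pairing f y.

HB.instance Definition _ k y := GRing.isLinear.Build K (Rambient A k) K^o *:%R
  (@pair_with k y) (@pairing_linear k y).

Section Injections.
Variables (F : finType) (U : vectType K).

Definition delta_ffun (X : F) (u : U) : {ffun F -> U} :=
  [ffun Y => if Y == X then u else 0].

Fact delta_ffun_linear X : linear (delta_ffun X).
Proof.
move=> a u v; apply/ffunP => Y; rewrite !ffunE.
by case: eqP => // _; rewrite scaler0 addr0.
Qed.

HB.instance Definition _ X := GRing.isLinear.Build K U {ffun F -> U} *:%R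
  (delta_ffun X) (delta_ffun_linear X).

Lemma sum_delta_ffun (f : {ffun F -> U}) : f = \sum_X delta_ffun X (f X).
Proof.
apply/ffunP => X; rewrite sum_ffunE (bigD1 X) //= big1 => [|Y nXY].
  by rewrite ffunE eqxx addr0.
by rewrite ffunE eq_sym (negPf nXY).
Qed.

Lemma sumf_delta X (u : U) : sumf (delta_ffun X u) = u.
Proof.
rewrite /sumf (bigD1 X) //= big1 => [|Y nXY]; first by rewrite ffunE eqxx addr0.
by rewrite ffunE (negPf nXY).
Qed.

Lemma delta_dsumv (P : pred F) (W : F -> {vspace U}) X u :
  P X -> u \in W X -> delta_ffun X u \in dsumv P W.
Proof.
move=> PX Wu; apply/mem_dsumv => Y; rewrite ffunE.
by case: eqP => [->|_]; rewrite ?PX ?mem0v.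
Qed.
End Injections.

Lemma pairing_functional k (l : 'Hom(Rambient A k, K^o)) :
  exists y : nested A V k, forall f, l f = pairing f y.
Proof.
elim: k l => [|k IH] l; first exact: form_functional.
have /skolem [y Hy] : forall Y : flat A, exists y : nested A V k,
    forall f, l (delta_ffun Y f) = pairing f y.
  move=> Y; have [y Hy] := IH (l \o linfun (@delta_ffun _ (Rambient A k) Y))%VF.
  by exists y => f; rewrite -Hy comp_lfunE lfunE.
exists ([ffun Y => y Y] : nested A V k.+1) => f.
rewrite {1}(sum_delta_ffun f) linear_sum; apply: eq_bigr => Y _.
apply: etrans (Hy Y (f Y)) _; by rewrite /at_flat ffunE.
Qed.

Lemma factor_functional (W Z : vectType K) (s : 'Hom(W, Z)) (P : {vspace W})
    (l : 'Hom(W, K^o)) : {in P, forall f, s f = 0 -> l f = 0} ->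
  exists l' : 'Hom(Z, K^o), {in P, forall f, l' (s f) = l f}.
Proof.
move=> lP; pose h := (s \o projv P)%VF.
exists (l \o projv P \o h^-1)%VF => f Pf; rewrite !comp_lfunE.
have hf : h f = s f by rewrite comp_lfunE projv_id.
set g := projv P _; have Pg : g \in P by apply: memv_proj.
have sg : s g = s f.
  by rewrite /g -[s (projv P _)]comp_lfunE -/h -hf limg_lfunVK ?memv_img ?memvf.
apply/eqP; rewrite -subr_eq0 -linearB; apply/eqP/lP; first by rewrite rpredB.
by rewrite linearB /= sg subrr.
Qed.

(** The witness u of a relation pairs to zero with a family of sum zero. *)
Lemma Rsub_perp k B f y : f \in Rsub k B -> const_rel B y -> pairing f y = 0.
Proof.
elim: k B f y => [|k IH] B f y; first by move=> /mem_Rsub0 f0 /f0.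
rewrite mem_RsubS => /andP[/mem_dsumv Rf /eqP f0] [u yu] /=.
have -> : \sum_Y pairing (f Y) (at_flat y Y) =
    \sum_Y pairing (f Y) (at_flat y Y - u) + \sum_Y pair_with u (f Y).
  by rewrite -big_split; apply: eq_bigr => Y _; rewrite pairingB /= subrK.
rewrite -linear_sum f0 linear0 addr0 big1 // => Y _.
have := Rf Y; case: (boolP (flat_of_rank k.+1 B Y)) => [BY RY|_].
  exact: IH RY (yu Y BY).
by rewrite memv0 => /eqP ->; apply: (linear0 (pair_with _)).
Qed.

(** A functional on the direct sum of the R(B_Y) that vanishes on the kernel of
    the sum map factors through that map; the factor is evaluation at some u, and
    u is the witness. *)
Lemma const_rel_perp k B (y : nested A V k) :
  (forall f, f \in Rsub k B -> pairing f y = 0) -> const_rel B y.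
Proof.
elim: k B y => [|k IH] B y y0.
  apply/mem_arr_center => H BH; apply: (y0 (alpha H)).
  by apply/mem_Rsub0 => v /mem_arr_center; apply.
pose W (Y : flat A) := Rsub k (localization B (val Y)).
have [|l Hl] := @factor_functional (Rambient A k.+1) _
    (linfun (@sumf K (flat A) (Rambient A k)))
    (dsumv (flat_of_rank k.+1 B) W) (linfun (@pair_with k.+1 y)).
  move=> f Wf; rewrite !lfunE => f0; apply: (y0 f).
  by rewrite mem_RsubS Wf; apply/eqP.
have [u Hu] := pairing_functional l; exists u => Y BY; apply: IH => f Wf.
have := Hl _ (delta_dsumv BY Wf); rewrite !lfunE /= sumf_delta Hu pairingB => ->.
rewrite /pair_with /= (bigD1 Y) //= big1 => [|Z nYZ].
  by rewrite ffunE eqxx addr0 subrr.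
by rewrite ffunE (negPf nYZ); apply: (linear0 (pair_with _)).
Qed.

Lemma Rsub_loc k B Y : (Rsub k (localization B Y) <= Rsub k B)%VS.
Proof.
case: k => [|k]; apply/subvP => f.
  move=> /mem_Rsub0 f0; apply/mem_Rsub0 => v Bv; apply: f0.
  by apply: subvP Bv; apply/arr_centerS/localizationS.
rewrite !mem_RsubS => /andP[/mem_dsumv Rf ->]; rewrite andbT.
apply/mem_dsumv => Z; have := Rf Z; case: ifP => [lZ|_]; last first.
  by rewrite memv0 => /eqP ->; apply: mem0v.
by have [-> ->] := flat_of_rank_loc lZ.
Qed.

(** An element of R(B) outside the image would be separated from the image by some
    y; this y annihilates every R(B_Y), so it is a relation for every B_Y, hence
    for B, and pairs to zero with R(B). *)
Lemma pi_surjectiveP k B :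
  (forall u : nested A V k, (forall Y : flat A, flat_of_rank k.+1 B Y ->
     const_rel (localization B (val Y)) u) -> const_rel B u) ->
  pi_surjective k.+1 B.
Proof.
move=> loc; rewrite /pi_surjective /=; set P := (_ @: _)%VS.
apply/eqP; rewrite eqEsubv; apply/andP; split; apply/subvP => f.
  case/memv_imgP => g /mem_dsumv Wg ->; rewrite lfunE /=.
  apply: rpred_sum => Y _; have := Wg Y; case: ifP => _; last first.
    by rewrite memv0 => /eqP ->; apply: mem0v.
  by apply/subvP/Rsub_loc.
move=> Rf; apply/negP => /negP /separate_vspace [l [lf lP]].
have [y Hy] := pairing_functional l.
have /eqP := lf; rewrite Hy (Rsub_perp Rf) ?(eq_sym 0) ?oner_eq0 //.
apply: loc => Y BY; apply: const_rel_perp => g Rg; rewrite -Hy; apply: lP.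
rewrite -(sumf_delta Y g); apply/memv_imgP; exists (delta_ffun Y g).
  exact: delta_dsumv BY Rg.
by rewrite lfunE.
Qed.

End Duality.

Theorem corollary4p10 (K : fieldType) (V : vectType K) (A : arrangement V)
    (m : A -> nat) (m_gt0 : forall H : A, (0 < m H)%N) :
  free_multiarrangement m -> totally_formal A.
Proof.
move=> free_m X _ k _; set B := localization _ X.
have clB : closed_subarr B by apply/closed_subarr_loc/closed_subarr_setT.
have surj j : pi_surjective j.+1 B.
  by apply: pi_surjectiveP => u; apply: (const_rel_locally m_gt0 free_m clB).
by elim: k => [|[|k] IH].
Qed.
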